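(* Let $A$ be a Hopf $*$-algebra, $B$ a left $A$-comodule $*$-algebra, and $\mathcal E$ an object of ${}^A_B\mathsf{Mod}_B$ which is finitely generated and projective as a left $B$-module. If $\mathscr H:\overline{\mathcal E}\to{}_B\mathrm{Hom}(\mathcal E,B)$ is an $A$-covariant Hermitian metric on $\mathcal E$, then for every unitary $2$-cocycle $\gamma$ on $A$ the map $$\mathscr H_\gamma:\overline{\Gamma(\mathcal E)}\to{}_{B_\gamma}\mathrm{Hom}(\Gamma(\mathcal E),B_\gamma),\qquad \mathscr H_\gamma=\mathfrak S\circ\Gamma(\mathscr H)\circ\mathfrak N_{\mathcal E},$$ is an $A_\gamma$-covariant Hermitian metric on $\Gamma(\mathcal E)$.
   Context: Hopf algebras and modules. Algebras are unital over $\mathbb C$, $\otimes=\otimes_{\mathbb C}$, Hopf algebras $(A,\Delta,\epsilon,S)$ have bijective antipode. A Hopf $*$-algebra is a Hopf algebra that is a $*$-algebra with $\Delta$ a $*$-homomorphism. Sweedler notation: $\Delta(a)=a_{(1)}\otimes a_{(2)}$; left coactions are $v\mapsto v_{(-1)}\otimes v_{(0)}$, iterated as $v_{(-2)}\otimes v_{(-1)}\otimes v_{(0)}$. A left $A$-comodule $*$-algebra is a left $A$-comodule algebra $B$ that is a $*$-algebra whose coaction is a $*$-homomorphism. ${}^A_B\mathsf{Mod}_B$ is the category of $B$-bimodules $\mathcal E$ with a left $A$-coaction satisfying $\delta(aeb)=\delta(a)\delta(e)\delta(b)$; morphisms are $A$-colinear $B$-bilinear maps. Cocycles. A $2$-cocycle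 on $A$ is a convolution-invertible linear $\gamma:A\otimes A\to\mathbb C$ (inverse $\bar\gamma$) with $\gamma(g_{(1)}\otimes h_{(1)})\gamma(g_{(2)}h_{(2)}\otimes k)=\gamma(h_{(1)}\otimes k_{(1)})\gamma(g\otimes h_{(2)}k_{(2)})$, always assumed unital: $\gamma(h\otimes1)=\epsilon(h)=\gamma(1\otimes h)$. It is unitary if $\overline{\gamma(a\otimes b)}=\bar\gamma(S(a)^*\otimes S(b)^* )$. Put $U(k)=\gamma(k_{(1)}\otimes S(k_{(2)}))$, $\bar U(k)=\bar\gamma(S(k_{(1)})\otimes k_{(2)})$, $V=U\circ S^{-1}$, $\bar V=\bar U\circ S^{-1}$, so $\bar V(k)=\bar\gamma(k_{(2)}\otimes S^{-1}(k_{(1)}))$. For unitary $\gamma$, $A_\gamma$ is the Hopf $*$-algebra with the coalgebra $A$, product $h\cdot_\gamma k=\gamma(h_{(1)}\otimes k_{(1)})h_{(2)}k_{(2)}\bar\gamma(h_{(3)}\otimes k_{(3)})$, antipode $S_\gamma(h)=U(h_{(1)})S(h_{(2)})\bar U(h_{(3)})$, involution $h^{*_\gamma}=\bar V(h_{(1)}^* )h_{(2)}^*V(h_{(3)}^* )$. $B_\gamma$ is the left $A_\gamma$-comodule $*$-algebra with underlying comodule $B$, $a\cdot_\gamma b=\gamma(a_{(-1)}\otimes b_{(-1)})a_{(0)}b_{(0)}$, $b^{*_\gamma}=\bar V(b_{(-1)}^* )b_{(0)}^*$. The functor $\Gamma:{}^A_B\mathsf{Mod}_B\to{}^{A_\gamma}_{B_\gamma}\mathsf{Mod}_{B_\gamma}$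 is the identity on underlying comodules and maps, with actions $b\cdot_\gamma m=\gamma(b_{(-1)}\otimes m_{(-1)})b_{(0)}m_{(0)}$, $m\cdot_\gamma b=\gamma(m_{(-1)}\otimes b_{(-1)})m_{(0)}b_{(0)}$. Conjugates and duals. For $M$ in ${}^A_B\mathsf{Mod}_B$, $\overline M=\{\overline m:m\in M\}$ is the conjugate vector space with $b\overline m=\overline{mb^*}$, $\overline mb=\overline{b^*m}$, coaction $\overline m\mapsto m_{(-1)}^*\otimes\overline{m_{(0)}}$. ${}_B\mathrm{Hom}(\mathcal E,B)$ is the space of left $B$-linear maps, with $(bf)(e)=f(eb)$, $(fb)(e)=f(e)b$ and coaction $f_{(-1)}\otimes f_{(0)}(e)=S(e_{(-1)})[f(e_{(0)})]_{(-1)}\otimes[f(e_{(0)})]_{(0)}$. An $A$-covariant Hermitian metric on $\mathcal E$ (finitely generated projective as a left $B$-module) is an isomorphism $\mathscr H:\overline{\mathcal E}\to{}_B\mathrm{Hom}(\mathcal E,B)$ in ${}^A_B\mathsf{Mod}_B$ such that $\langle x,\overline y\rangle:=\mathscr H(\overline y)(x)$ satisfies $\langle y,\overline x\rangle^*=\langle x,\overline y\rangle$ for all $x,y\in\mathcal E$. An $A_\gamma$-covariant Hermitian metric on $\Gamma(\mathcal E)$ is the same notion with $(A_\gamma,B_\gamma,*_\gamma)$. The maps. $\mathfrak S:\Gamma({}_B\mathrm{Hom}(\mathcal E,B))\to{}_{B_\gamma}\mathrm{Hom}(\Gamma(\mathcal E),B_\gamma)$ is $\mathfrak S(f)(v)=\gamma\big(v_{(-2)}\otimes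 S(v_{(-1)})[f(v_{(0)})]_{(-1)}\big)[f(v_{(0)})]_{(0)}$, and $\mathfrak N_{\mathcal E}:\overline{\Gamma(\mathcal E)}\to\Gamma(\overline{\mathcal E})$ is $\mathfrak N_{\mathcal E}(\overline e)=\bar V(e_{(-1)}^* )\,\overline{e_{(0)}}$. *)

(* Defs.v *)
From HB Require Import structures.
From mathcomp Require Import all_boot all_order all_algebra.
From mathcomp Require Import generic_quotient sesquilinear.
From mathcomp Require Import boolp classical_sets functions reals.
From mathcomp Require Import complex.

Set Implicit Arguments.
Unset Strict Implicit.
Unset Printing Implicit Defensive.

Import Order.TTheory GRing.Theory Num.Theory.
Local Open Scope ring_scope.
Local Open Scope quotient_scope.

(* Formal finite sums of pairs, two of them being identified when no bilinear
   map distinguishes them: the universal property of the tensor product holds by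
   construction (tsum_tens, tsum_linear, tensor_span). *)
Section Tensor.
Context (C : numClosedFieldType) (V W : lmodType C).

Definition teqv (s t : seq (V * W)) : bool :=
  `[< forall (X : lmodType C) (f : {bilinear V -> W -> X}),
        \sum_(p <- s) f p.1 p.2 = \sum_(p <- t) f p.1 p.2 >].

Lemma teqv_refl : reflexive teqv.
Proof. by move=> s; apply/asboolP. Qed.

Lemma teqv_sym : symmetric teqv.
Proof. by move=> s t; apply/asboolP/asboolP => h X f; rewrite h. Qed.

Lemma teqv_trans : transitive teqv.
Proof. by move=> s t u /asboolP h1 /asboolP h2; apply/asboolP => X f; rewrite h1. Qed.

Canonical teqv_equiv := EquivRel teqv teqv_refl teqv_sym teqv_trans.

Definition tensor : Type := {eq_quot teqv_equiv}.
HB.instance Definition _ := Choice.on tensor.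

Definition tpi (s : seq (V * W)) : tensor := \pi_({eq_quot teqv_equiv}) s.
Definition trepr (t : tensor) : seq (V * W) := @repr _ {eq_quot teqv_equiv} t.

(* On v (x) w this is f v w, extended (anti)linearly, when f is bilinear
   (tsum_tens, tsum_linear) or antilinear in both arguments (tsum_tens_anti,
   tsum_antilinear); for other f the value has no meaning. *)
Definition tsum (X : nmodType) (f : V -> W -> X) (t : tensor) : X :=
  \sum_(p <- trepr t) f p.1 p.2.

Lemma tsum_pi (X : lmodType C) (f : {bilinear V -> W -> X}) s :
  tsum f (tpi s) = \sum_(p <- s) f p.1 p.2.
Proof.
move: X f; apply/asboolP; rewrite -/(teqv _ _).
by rewrite -[teqv _ _]/(teqv_equiv _ _) -eqmodE /trepr reprK.
Qed.

Lemma tensor_ext (t u : tensor) :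
  (forall (X : lmodType C) (f : {bilinear V -> W -> X}), tsum f t = tsum f u) ->
  t = u.
Proof.
move=> h; rewrite -[t](@reprK _ {eq_quot teqv_equiv}).
rewrite -[u](@reprK _ {eq_quot teqv_equiv}); apply/eqP.
by rewrite eqmodE; apply/asboolP => X f; exact: h.
Qed.

Definition scale_seq (c : C) (s : seq (V * W)) := [seq (c *: p.1, p.2) | p <- s].

Definition tadd (t u : tensor) : tensor := tpi (trepr t ++ trepr u).
Definition tscale (c : C) (t : tensor) : tensor := tpi (scale_seq c (trepr t)).

Lemma tsum_tadd (X : lmodType C) (f : {bilinear V -> W -> X}) t u :
  tsum f (tadd t u) = tsum f t + tsum f u.
Proof. by rewrite tsum_pi big_cat. Qed.

Lemma tsum_tscale (X : lmodType C) (f : {bilinear V -> W -> X}) c t :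
  tsum f (tscale c t) = c *: tsum f t.
Proof.
rewrite tsum_pi big_map scaler_sumr; apply: eq_bigr => p _ /=.
by rewrite linearZl_LR.
Qed.

Lemma tsum_tzero (X : lmodType C) (f : {bilinear V -> W -> X}) :
  tsum f (tpi [::]) = 0.
Proof. by rewrite tsum_pi big_nil. Qed.

Lemma taddA : associative tadd.
Proof. by move=> t u v; apply: tensor_ext => X f; rewrite !tsum_tadd addrA. Qed.

Lemma taddC : commutative tadd.
Proof. by move=> t u; apply: tensor_ext => X f; rewrite !tsum_tadd addrC. Qed.

Lemma tadd0 : left_id (tpi [::]) tadd.
Proof. by move=> t; apply: tensor_ext => X f; rewrite tsum_tadd tsum_tzero add0r. Qed.

Lemma taddN : left_inverse (tpi [::]) (tscale (-1)) tadd.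
Proof.
move=> t; apply: tensor_ext => X f.
by rewrite tsum_tadd tsum_tscale tsum_tzero scaleN1r addNr.
Qed.

HB.instance Definition _ := GRing.isZmodule.Build tensor taddA taddC tadd0 taddN.

Lemma tscaleA a b (t : tensor) : tscale a (tscale b t) = tscale (a * b) t.
Proof. by apply: tensor_ext => X f; rewrite !tsum_tscale scalerA. Qed.

Lemma tscale1 : left_id 1 tscale.
Proof. by move=> t; apply: tensor_ext => X f; rewrite !tsum_tscale scale1r. Qed.

Lemma tscaleDr : right_distributive tscale +%R.
Proof.
move=> c t u; apply: tensor_ext => X f.
by rewrite tsum_tadd !tsum_tscale tsum_tadd scalerDr.
Qed.

Lemma tscaleDl (t : tensor) : {morph tscale^~ t : a b / a + b}.
Proof.
move=> a b; apply: tensor_ext => X f.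
by rewrite tsum_tadd !tsum_tscale scalerDl.
Qed.

HB.instance Definition _ :=
  GRing.Zmodule_isLmodule.Build C tensor tscaleA tscale1 tscaleDr tscaleDl.

Definition tens (v : V) (w : W) : tensor := tpi [:: (v, w)].

Lemma tsum_tens (X : lmodType C) (f : {bilinear V -> W -> X}) v w :
  tsum f (tens v w) = f v w.
Proof. by rewrite tsum_pi big_seq1. Qed.

Lemma tsum_linear (X : lmodType C) (f : {bilinear V -> W -> X}) : linear (tsum f).
Proof. by move=> c t u; rewrite tsum_tadd tsum_tscale. Qed.

Section Extension.
Variables (X : lmodType C) (f : V -> W -> X) (f_bil : bilinear_for *:%R *:%R f).

HB.instance Definition _ := bilinear_isBilinear.Build C V W X _ _ f f_bil.

Lemma tsum_tens_bil v w : tsum f (tens v w) = f v w.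
Proof. exact: tsum_tens. Qed.

Lemma tsum_linear_bil : linear (tsum f).
Proof. exact: tsum_linear. Qed.

End Extension.

Lemma tens_bilinear : bilinear_for *:%R *:%R tens.
Proof.
split=> [w|v] c x y; apply: tensor_ext => X f; rewrite tsum_linear !tsum_tens.
  exact: linearPl.
exact: linearPr.
Qed.

HB.instance Definition _ :=
  bilinear_isBilinear.Build C V W tensor _ _ tens tens_bilinear.

Lemma tensor_span (t : tensor) : t = \sum_(p <- trepr t) tens p.1 p.2.
Proof.
have sumE (s : seq (V * W)) : tpi s = \sum_(p <- s) tens p.1 p.2.
  elim: s => [|p s ih]; first by rewrite big_nil.
  rewrite big_cons -ih; apply: tensor_ext => X f.
  by rewrite tsum_tadd tsum_tens !tsum_pi big_cons.
by rewrite -sumE /tpi /trepr reprK.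
Qed.

End Tensor.

Arguments tens {C V W} v w : simpl never.
Arguments tsum {C V W X} f t : simpl never.

(* Sweedler notation *)
Notation "\tsum_ ( a , b <- t ) F" := (tsum (fun a b => F) t)
  (at level 41, F at level 41, a name, b name,
   format "'[' \tsum_ ( a ,  b  <-  t ) '/  '  F ']'") : ring_scope.

Section Conjugate.
Context (C : numClosedFieldType) (V : lmodType C).

Definition conjv : Type := V.
HB.instance Definition _ := GRing.Zmodule.on conjv.

Definition bar (v : V) : conjv := v.
Definition unbar (v : conjv) : V := v.

Definition conj_scale (c : C) (v : conjv) : conjv := bar (c^* *: unbar v).

Lemma conj_scaleA a b v : conj_scale a (conj_scale b v) = conj_scale (a * b) v.
Proof. by rewrite /conj_scale scalerA rmorphM. Qed.

Lemma conj_scale1 : left_id 1 conj_scale.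
Proof. by move=> v; rewrite /conj_scale rmorph1 scale1r. Qed.

Lemma conj_scaleDr : right_distributive conj_scale +%R.
Proof. by move=> c u v; rewrite /conj_scale scalerDr. Qed.

Lemma conj_scaleDl v : {morph conj_scale^~ v : a b / a + b}.
Proof. by move=> a b; rewrite /conj_scale rmorphD scalerDl. Qed.

HB.instance Definition _ := GRing.Zmodule_isLmodule.Build C conjv
  conj_scaleA conj_scale1 conj_scaleDr conj_scaleDl.

End Conjugate.

Definition antilinear (C : numClosedFieldType) (V W : lmodType C) (f : V -> W) :=
  forall (c : C) u v, f (c *: u + v) = c^* *: f u + f v.

Section TensorAnti.
Context (C : numClosedFieldType) (V W X : lmodType C) (f : V -> W -> X).
Hypothesis f_antil : forall w, antilinear (f^~ w).
Hypothesis f_antir : forall v, antilinear (f v).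

Let g (v : V) (w : W) : conjv X := bar (f v w).

Let g_bilinear : bilinear_for *:%R *:%R g.
Proof. by split=> [w|v] c x y; [exact: f_antil | exact: f_antir]. Qed.

HB.instance Definition _ := bilinear_isBilinear.Build C V W (conjv X) _ _ g g_bilinear.

Lemma tsum_tens_anti v w : tsum f (tens v w) = f v w.
Proof. exact: (tsum_tens g). Qed.

Lemma tsum_antilinear : antilinear (tsum f).
Proof. exact: (tsum_linear g). Qed.

End TensorAnti.

(* The structures below carry operations only, because twisting by a cocycle is
   given by formulas; the axioms are the predicates is_hopf_star_algebra,
   is_comodule_star_algebra and is_covariant_bimodule. *)

Record hopfStarData (C : numClosedFieldType) := HopfStarData {
  hopf_sort :> lmodType C;
  hmul : hopf_sort -> hopf_sort -> hopf_sort;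
  hone : hopf_sort;
  hstar : hopf_sort -> hopf_sort;
  comul : hopf_sort -> tensor hopf_sort hopf_sort;
  counit : hopf_sort -> C;
  antipode : hopf_sort -> hopf_sort }.

Arguments hmul {C} A : rename.
Arguments hone {C} A : rename.
Arguments hstar {C} A : rename.
Arguments comul {C} A : rename.
Arguments counit {C} A : rename.
Arguments antipode {C} A : rename.

Record is_hopf_star_algebra (C : numClosedFieldType) (A : hopfStarData C) : Prop := {
  hmul_bilinear : bilinear_for *:%R *:%R (hmul A);
  hmulA : associative (hmul A);
  hmul1 : left_id (hone A) (hmul A);
  hmulr1 : right_id (hone A) (hmul A);
  comul_linear : linear (comul A);
  comulA : forall a,
    \tsum_(a12, a3 <- comul A a) \tsum_(a1, a2 <- comul A a12)
      tens a1 (tens a2 a3) =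
    \tsum_(a1, a23 <- comul A a) tens a1 (comul A a23);
  counit_linear : scalar (counit A);
  counitl : forall a, \tsum_(a1, a2 <- comul A a) counit A a1 *: a2 = a;
  counitr : forall a, \tsum_(a1, a2 <- comul A a) counit A a2 *: a1 = a;
  comul1 : comul A (hone A) = tens (hone A) (hone A);
  comulM : forall a b, comul A (hmul A a b) =
    \tsum_(a1, a2 <- comul A a) \tsum_(b1, b2 <- comul A b)
      tens (hmul A a1 b1) (hmul A a2 b2);
  counit1 : counit A (hone A) = 1;
  counitM : forall a b, counit A (hmul A a b) = counit A a * counit A b;
  antipode_linear : linear (antipode A);
  antipodel : forall a,
    \tsum_(a1, a2 <- comul A a) hmul A (antipode A a1) a2 = counit A a *: hone A;
  antipoder : forall a,
    \tsum_(a1, a2 <- comul A a) hmul A a1 (antipode A a2) = counit A a *: hone A;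
  antipode_bij : bijective (antipode A);
  hstar_antilinear : antilinear (hstar A);
  hstarK : involutive (hstar A);
  hstarM : forall a b, hstar A (hmul A a b) = hmul A (hstar A b) (hstar A a);
  comul_star : forall a, comul A (hstar A a) =
    \tsum_(a1, a2 <- comul A a) tens (hstar A a1) (hstar A a2) }.

(* The product is required to be bilinear here since this is what makes the left
   B-linear maps into B a vector space. *)
Record comodStarData (C : numClosedFieldType) (A : hopfStarData C) := ComodStarData {
  comod_sort :> lmodType C;
  bmul : {bilinear comod_sort -> comod_sort -> comod_sort};
  bone : comod_sort;
  bstar : comod_sort -> comod_sort;
  bcoact : {linear comod_sort -> tensor A comod_sort} }.

Arguments bmul {C A} B : rename.
Arguments bone {C A} B : rename.
Arguments bstar {C A} B : rename.
Arguments bcoact {C A} B : rename.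

Record is_comodule (C : numClosedFieldType) (A : hopfStarData C) (M : lmodType C)
    (delta : M -> tensor A M) : Prop := {
  coact_linear : linear delta;
  coactA : forall m,
    \tsum_(m1, m0 <- delta m) \tsum_(a1, a2 <- comul A m1) tens a1 (tens a2 m0) =
    \tsum_(m1, m0 <- delta m) tens m1 (delta m0);
  coact_counit : forall m, \tsum_(m1, m0 <- delta m) counit A m1 *: m0 = m }.

Record is_comodule_star_algebra (C : numClosedFieldType) (A : hopfStarData C)
    (B : comodStarData A) : Prop := {
  bmulA : associative (bmul B);
  bmul1 : left_id (bone B) (bmul B);
  bmulr1 : right_id (bone B) (bmul B);
  bstar_antilinear : antilinear (bstar B);
  bstarK : involutive (bstar B);
  bstarM : forall a b, bstar B (bmul B a b) = bmul B (bstar B b) (bstar B a);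
  bcoact_comodule : is_comodule (bcoact B);
  bcoact1 : bcoact B (bone B) = tens (hone A) (bone B);
  bcoactM : forall a b, bcoact B (bmul B a b) =
    \tsum_(a1, a0 <- bcoact B a) \tsum_(b1, b0 <- bcoact B b)
      tens (hmul A a1 b1) (bmul B a0 b0);
  bcoact_star : forall b, bcoact B (bstar B b) =
    \tsum_(b1, b0 <- bcoact B b) tens (hstar A b1) (bstar B b0) }.

Record bimodData (C : numClosedFieldType) (A : hopfStarData C)
    (B : comodStarData A) := BimodData {
  bimod_sort :> lmodType C;
  lact : B -> bimod_sort -> bimod_sort;
  ract : bimod_sort -> B -> bimod_sort;
  coact : bimod_sort -> tensor A bimod_sort }.

Arguments lact {C A B} M : rename.
Arguments ract {C A B} M : rename.
Arguments coact {C A B} M : rename.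

Section Modules.
Context (C : numClosedFieldType) (A : hopfStarData C) (B : comodStarData A).

Record is_left_module (M : lmodType C) (act : B -> M -> M) : Prop := {
  lact_bilinear : bilinear_for *:%R *:%R act;
  lactA : forall a b m, act (bmul B a b) m = act a (act b m);
  lact1 : forall m, act (bone B) m = m }.

Record is_covariant_bimodule (M : bimodData B) : Prop := {
  lact_module : is_left_module (lact M);
  ract_bilinear : bilinear_for *:%R *:%R (ract M);
  ractA : forall m a b, ract M m (bmul B a b) = ract M (ract M m a) b;
  ract1 : forall m, ract M m (bone B) = m;
  lractA : forall a m b, ract M (lact M a m) b = lact M a (ract M m b);
  coact_comodule : is_comodule (coact M);
  coactM : forall a m b, coact M (ract M (lact M a m) b) =
    \tsum_(a1, a0 <- bcoact B a) \tsum_(m1, m0 <- coact M m)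
    \tsum_(b1, b0 <- bcoact B b)
      tens (hmul A (hmul A a1 m1) b1) (ract M (lact M a0 m0) b0) }.

Definition left_module_map (M N : lmodType C) (actM : B -> M -> M)
    (actN : B -> N -> N) (f : M -> N) : Prop :=
  linear f /\ forall b m, f (actM b m) = actN b (f m).

Definition finitely_generated (M : lmodType C) (act : B -> M -> M) : Prop :=
  exists (n : nat) (x : 'I_n -> M),
    forall m, exists b : 'I_n -> B, m = \sum_(i < n) act (b i) (x i).

Definition projective (M : lmodType C) (act : B -> M -> M) : Prop :=
  forall (P Q : lmodType C) (actP : B -> P -> P) (actQ : B -> Q -> Q),
    is_left_module actP -> is_left_module actQ ->
  forall (p : P -> Q) (g : M -> Q),
    left_module_map actP actQ p -> (forall q, exists x, p x = q) ->
    left_module_map act actQ g ->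
  exists2 h : M -> P, left_module_map act actP h & forall m, p (h m) = g m.

Record is_morphism (M N : bimodData B) (f : M -> N) : Prop := {
  morph_linear : linear f;
  morph_lact : forall b m, f (lact M b m) = lact N b (f m);
  morph_ract : forall m b, f (ract M m b) = ract N (f m) b;
  morph_coact : forall m, coact N (f m) =
    \tsum_(m1, m0 <- coact M m) tens m1 (f m0) }.

Definition is_isomorphism (M N : bimodData B) (f : M -> N) : Prop :=
  is_morphism f /\
  exists g : N -> M, [/\ is_morphism g, cancel f g & cancel g f].

Definition conj_bimod (M : bimodData B) : bimodData B := @BimodData C A B (conjv M)
  (fun b m => bar (ract M (unbar m) (bstar B b)))
  (fun m b => bar (lact M (bstar B b) (unbar m)))
  (fun m => \tsum_(m1, m0 <- coact M (unbar m)) tens (hstar A m1) (bar m0)).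

End Modules.

Section Hom.
Context (C : numClosedFieldType) (A : hopfStarData C) (B : comodStarData A).
Context (E : bimodData B).

Definition is_homB : {pred E -> B} :=
  fun f => `[< left_module_map (lact E) (bmul B) f >].

Record homB := HomB { homB_fun :> E -> B; homB_prop : homB_fun \in is_homB }.

HB.instance Definition _ := [isSub for homB_fun].
HB.instance Definition _ := [Choice of homB by <:].

Lemma is_homB_submod : submod_closed is_homB.
Proof.
split=> [|c f g /asboolP[fl fB] /asboolP[gl gB]]; apply/asboolP; split.
- by move=> k x y; rewrite scaler0 addr0.
- by move=> b e; rewrite linear0r.
- move=> k x y; rewrite !fctE fl gl /= !scalerDr !scalerA (mulrC c k).
  by rewrite addrACA.
- by move=> b e; rewrite !fctE fB gB linearPr.
Qed.

HB.instance Definition _ := GRing.isSubmodClosed.Build C (E -> B) is_homB is_homB_submod.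
HB.instance Definition _ := [SubChoice_isSubLmodule of homB by <:].

(* f as an element of Hom; it is used only for left B-linear f *)
Definition to_homB (f : E -> B) : homB := insubd (0 : homB) f.

Lemma to_homBE (f : E -> B) : left_module_map (lact E) (bmul B) f ->
  to_homB f = f :> (E -> B).
Proof. by move=> hf; rewrite /to_homB [LHS]insubdK//; apply/asboolP. Qed.

(* the element f_(-1) (x) f_(0) of A (x) Hom, determined by its evaluations *)
Definition hom_coact (f : homB) : tensor A homB :=
  xget (0 : tensor A homB) [set t : tensor A homB | forall e : E,
    \tsum_(a, g <- t) tens a ((g : homB) e) =
    \tsum_(e1, e0 <- coact E e) \tsum_(w1, w0 <- bcoact B (f e0))
      tens (hmul A (antipode A e1) w1) w0]%classic.

Definition hom_bimod : bimodData B := @BimodData C A B homB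
  (fun b f => to_homB (fun e => f (ract E e b)))
  (fun f b => to_homB (fun e => bmul B (f e) b))
  hom_coact.

Lemma hom_lactE (f : homB) b : is_covariant_bimodule E ->
  lact hom_bimod b f = (fun e => f (ract E e b)) :> (E -> B).
Proof.
move=> hE; apply: to_homBE; have /asboolP[fl fB] := homB_prop f.
split=> [c x y|a e]; first by rewrite (ract_bilinear hE).1 fl.
by rewrite (lractA hE) fB.
Qed.

Lemma hom_ractE (f : homB) b : is_comodule_star_algebra B ->
  ract hom_bimod f b = (fun e => bmul B (f e) b) :> (E -> B).
Proof.
move=> hB; apply: to_homBE; have /asboolP[fl fB] := homB_prop f.
split=> [c x y|a e]; first by rewrite fl linearPl.
by rewrite fB (bmulA hB).
Qed.

(* <x, bar y> = H (bar y) x *)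
Record is_hermitian_metric (H : conj_bimod E -> hom_bimod) : Prop := {
  metric_fg : finitely_generated (lact E);
  metric_proj : projective (lact E);
  metric_iso : is_isomorphism H;
  metric_herm : forall x y : E,
    bstar B ((H (bar x) : homB) y) = (H (bar y) : homB) x }.

End Hom.

Section Twist.
Context (C : numClosedFieldType) (A : hopfStarData C).
Implicit Types (g : {scalar tensor A A}).

(* g is the cocycle and gbar its convolution inverse *)
Record is_unitary_2cocycle (g gbar : {scalar tensor A A}) : Prop := {
  cocycle_invr : forall a b,
    \tsum_(a1, a2 <- comul A a) \tsum_(b1, b2 <- comul A b)
      (g (tens a1 b1) * gbar (tens a2 b2)) = counit A a * counit A b;
  cocycle_invl : forall a b,
    \tsum_(a1, a2 <- comul A a) \tsum_(b1, b2 <- comul A b)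
      (gbar (tens a1 b1) * g (tens a2 b2)) = counit A a * counit A b;
  cocycleP : forall a b c,
    \tsum_(a1, a2 <- comul A a) \tsum_(b1, b2 <- comul A b)
      (g (tens a1 b1) * g (tens (hmul A a2 b2) c)) =
    \tsum_(b1, b2 <- comul A b) \tsum_(c1, c2 <- comul A c)
      (g (tens b1 c1) * g (tens a (hmul A b2 c2)));
  cocycle1r : forall a, g (tens a (hone A)) = counit A a;
  cocycle1l : forall a, g (tens (hone A) a) = counit A a;
  cocycle_unitary : forall a b, (g (tens a b))^* =
    gbar (tens (hstar A (antipode A a)) (hstar A (antipode A b))) }.

Definition antipode_inv (a : A) : A := xget 0 [set b | antipode A b = a]%classic.

Definition cocU g (k : A) : C :=
  \tsum_(k1, k2 <- comul A k) g (tens k1 (antipode A k2)).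
Definition cocUbar gbar (k : A) : C :=
  \tsum_(k1, k2 <- comul A k) gbar (tens (antipode A k1) k2).
Definition cocV g (k : A) : C := cocU g (antipode_inv k).
Definition cocVbar gbar (k : A) : C := cocUbar gbar (antipode_inv k).

Context (g gbar : {scalar tensor A A}).

Definition twist_hopf : hopfStarData C := @HopfStarData C (hopf_sort A)
  (fun h k =>
    \tsum_(h1, h23 <- comul A h) \tsum_(h2, h3 <- comul A h23)
    \tsum_(k1, k23 <- comul A k) \tsum_(k2, k3 <- comul A k23)
      (g (tens h1 k1) * gbar (tens h3 k3)) *: hmul A h2 k2)
  (hone A)
  (fun h =>
    \tsum_(h1, h23 <- comul A h) \tsum_(h2, h3 <- comul A h23)
      (cocVbar gbar (hstar A h1) * cocV g (hstar A h3)) *: hstar A h2)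
  (comul A)
  (counit A)
  (fun h =>
    \tsum_(h1, h23 <- comul A h) \tsum_(h2, h3 <- comul A h23)
      (cocU g h1 * cocUbar gbar h3) *: antipode A h2).

Section TwistComodule.
Context (B : comodStarData A).

Definition twist_bmul (a b : B) : B :=
  \tsum_(a1, a0 <- bcoact B a) \tsum_(b1, b0 <- bcoact B b)
    g (tens a1 b1) *: bmul B a0 b0.

Lemma twist_bmul_bilinear : bilinear_for *:%R *:%R twist_bmul.
Proof.
pose F (a1 : A) (a0 : B) (b1 : A) (b0 : B) := g (tens a1 b1) *: bmul B a0 b0.
have Fr a1 a0 : bilinear_for *:%R *:%R (F a1 a0).
  split=> [w|v] c x y; rewrite /F.
    by rewrite linearPr linearP scalerDl -scalerA.
  by rewrite linearPr scalerDr /= scalerA mulrC -scalerA.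
have Fl b1 b0 : bilinear_for *:%R *:%R (fun a1 a0 => F a1 a0 b1 b0).
  split=> [w|v] c x y; rewrite /F.
    by rewrite linearPl linearP scalerDl -scalerA.
  by rewrite linearPl scalerDr /= scalerA mulrC -scalerA.
split=> [b|a] c x y.
  have swap a : twist_bmul a b = \sum_(q <- trepr (bcoact B b))
      tsum (fun a1 a0 => F a1 a0 q.1 q.2) (bcoact B a).
    by rewrite /twist_bmul /tsum exchange_big.
  suff -> : twist_bmul (c *: x + y) b = c *: twist_bmul x b + twist_bmul y b by [].
  rewrite !swap scaler_sumr -big_split; apply: eq_bigr => q _ /=.
  by rewrite linearP (tsum_linear_bil (Fl q.1 q.2)).
suff -> : twist_bmul a (c *: x + y) = c *: twist_bmul a x + twist_bmul a y by [].
have unfold b : twist_bmul a b = \sum_(q <- trepr (bcoact B a))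
    tsum (F q.1 q.2) (bcoact B b) by [].
rewrite !unfold scaler_sumr -big_split; apply: eq_bigr => q _ /=.
by rewrite linearP (tsum_linear_bil (Fr q.1 q.2)).
Qed.

HB.instance Definition _ :=
  bilinear_isBilinear.Build C B B B _ _ twist_bmul twist_bmul_bilinear.

Definition twist_comod : comodStarData twist_hopf :=
  @ComodStarData C twist_hopf (comod_sort B)
    twist_bmul
    (bone B)
    (fun b => \tsum_(b1, b0 <- bcoact B b)
                cocVbar gbar (hstar A b1) *: bstar B b0)
    (bcoact B).

(* the functor Gamma, on objects and on morphisms *)
Definition Gamma (M : bimodData B) : bimodData twist_comod :=
  @BimodData C twist_hopf twist_comod (bimod_sort M)
    (fun b m => \tsum_(b1, b0 <- bcoact B b) \tsum_(m1, m0 <- coact M m)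
                  g (tens b1 m1) *: lact M b0 m0)
    (fun m b => \tsum_(m1, m0 <- coact M m) \tsum_(b1, b0 <- bcoact B b)
                  g (tens m1 b1) *: ract M m0 b0)
    (coact M).

Definition Gamma_map (M N : bimodData B) (f : M -> N) : Gamma M -> Gamma N := f.

Section Metric.
Context (E : bimodData B).

Definition frakS (f : Gamma (hom_bimod E)) : hom_bimod (Gamma E) :=
  @to_homB C twist_hopf twist_comod (Gamma E) (fun v : E =>
    \tsum_(v1, v0 <- coact E v) \tsum_(a, b <- comul A v1)
    \tsum_(w1, w0 <- bcoact B ((f : homB E) v0))
      g (tens a (hmul A (antipode A b) w1)) *: w0).

Definition frakN (e : conj_bimod (Gamma E)) : Gamma (conj_bimod E) :=
  \tsum_(e1, e0 <- coact E (unbar e)) cocVbar gbar (hstar A e1) *: bar e0.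

Definition twist_metric (H : conj_bimod E -> hom_bimod E) :
    conj_bimod (Gamma E) -> hom_bimod (Gamma E) :=
  frakS \o Gamma_map H \o frakN.

End Metric.
End TwistComodule.
End Twist.

Arguments twist_hopf {C A} g gbar.
Arguments twist_comod {C A} g gbar B.
Arguments Gamma {C A} g gbar {B} M.
Arguments Gamma_map {C A} g gbar {B M N} f.
Arguments frakS {C A} g gbar {B E} f.
Arguments frakN {C A} g gbar {B E} e.
Arguments twist_metric {C A} g gbar {B E} H.

(* Main.v *)
Require Import Defs.
From mathcomp Require Import all_boot all_order all_algebra sesquilinear.
From mathcomp Require Import boolp classical_sets reals complex ring.

Set Implicit Arguments.
Unset Strict Implicit.
Unset Printing Implicit Defensive.

Import Order.TTheory GRing.Theory Num.Theory.
Local Open Scope ring_scope.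

(** Write p(e, n) = H(n)(e) for e in E and n in Ebar, where Ebar is the conjugate
    of E. That H is a covariant Hermitian metric means that p : E x Ebar -> B is
    left and right B-linear, balanced over B, colinear for the diagonal coaction
    of A on E (x) Ebar, that p(x, bar y) and p(y, bar x) are exchanged by the
    involution of B, and, E being finitely generated projective and H bijective,
    that E has a dual basis e = sum_i p(e, y_i) x_i ([pairing_colinear],
    [pairing_dual_basis]).

    Let mu_g(m, n) = g(m_(-1), n_(-1)) mu(m_(0), n_(0)) be the deformation of a
    colinear product mu ([twist_prod]); the product of B_g, the actions on
    Gamma(M) and the map below are all of this form. Unwinding the definitions
    with the colinearity of p gives
      H_g(bar y)(x) = p_g(x, N y),   N y = Vbar(y_(-1)^* ) bar (y_(0)),
    ([twist_metricE]), and the theorem becomes the statement that p_g and N have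
    the properties listed above for the deformed structures. Four facts
    suffice.

    - A relation al(mu(m, n), r) = be(m, nu(n, r)) between colinear products is
      inherited by their deformations; this is the cocycle identity
      ([twist_prodA]). Hence p_g is left and right linear and balanced.

    - If antilinear comodule maps J reverse a product, J(mu(m, n)) = mu'(J n, J m),
      then so do their deformations m |-> Vbar(m_(-1)^* ) J(m_(0)) with respect to
      the deformed products ([conj_twist_prod]). The involution of B_g, the map N
      and its inverse are such deformations, so N carries the conjugates of the
      deformed actions on E to the deformed actions on Ebar, and applied to p
      itself the same statement is the Hermitian symmetry of p_g. It rests on an identity expressing the failure of Vbar to be
      multiplicative ([cocVbar_mul]) and on V and Vbar being inverse to each
      other; one of the two orders comes from the cocycle identity, the other
      from it by complex conjugation, since g is unitary.

    - The element sum_i y_i (x) x_i of Ebar (x)_B E is coinvariant, which makes the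
      family of the terms of sum_i gbar(y_i(-1), x_i(-1)) y_i(0) (x) x_i(0) a dual
      basis for p_g ([twisted_expansion]). So Gamma(E) is finitely generated and
      projective, and H_g is onto; by Hermitian symmetry it is one-to-one.

    - H_g is colinear because S_g(x_(1)) ._g x_(2) = eps(x) in the deformed Hopf
      algebra, in the form [twisted_antipode_cancel]. An element of
      A (x) Hom(Gamma(E), B_g) is determined by its evaluations, by the dual basis
      again ([twist_hom_coact_uniq]), so the coaction of H_g(n) is pinned down by
      its values. *)

(** * Multilinear maps and sums over tensors *)

Section Linearity.
Context {C : numClosedFieldType}.
Implicit Types U V W X : lmodType C.

(** Predicates on bare functions, so that linearity can be proved by following the
    syntax of an expression. Maps into C are kept apart from maps into the module
    C^o: the expressions summed in C are products in the field. *)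
Definition lin V X (f : V -> X) := forall c u v, f (c *: u + v) = c *: f u + f v.
Definition slin V (f : V -> C) := forall c u v, f (c *: u + v) = c * f u + f v.
Definition bilin V W X (f : V -> W -> X) :=
  (forall w, lin (fun v => f v w)) /\ (forall v, lin (f v)).

Lemma lin_id V : lin (fun x : V => x). Proof. by []. Qed.

Lemma lin_comp V W X (f : W -> X) (g : V -> W) :
  lin f -> lin g -> lin (fun x => f (g x)).
Proof. by move=> hf hg c u v; rewrite hg hf. Qed.

Lemma slin_comp V W (f : W -> C) (g : V -> W) :
  slin f -> lin g -> slin (fun x => f (g x)).
Proof. by move=> hf hg c u v; rewrite hg hf. Qed.

Lemma lin_bil V W X (f : V -> W -> X) : bilin f ->
  forall U (h : U -> V) w, lin h -> lin (fun x => f (h x) w).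
Proof. by move=> [hf _] U h w hh; apply: (lin_comp (hf w)). Qed.

Lemma lin_bir V W X (f : V -> W -> X) : bilin f ->
  forall U (h : U -> W) v, lin h -> lin (fun x => f v (h x)).
Proof. by move=> [_ hf] U h v hh; apply: (lin_comp (hf v)). Qed.

Lemma lin0 V X (f : V -> X) : lin f -> f 0 = 0.
Proof. by move=> /(_ (-1) 0 0); rewrite scaler0 add0r scaleN1r addNr. Qed.

Lemma linD V X (f : V -> X) u v : lin f -> f (u + v) = f u + f v.
Proof. by move=> h; have := h 1 u v; rewrite !scale1r. Qed.

Lemma linZ V X (f : V -> X) c u : lin f -> f (c *: u) = c *: f u.
Proof. by move=> h; have := h c u 0; rewrite (lin0 h) !addr0. Qed.

Lemma slinZ V (f : V -> C) c u : slin f -> f (c *: u) = c * f u.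
Proof. exact: (@linZ V C^o). Qed.

Lemma lin_sum V X (f : V -> X) I (r : seq I) (F : I -> V) : lin f ->
  f (\sum_(i <- r) F i) = \sum_(i <- r) f (F i).
Proof.
move=> h; elim: r => [|i r ih]; first by rewrite !big_nil lin0.
by rewrite !big_cons linD// ih.
Qed.

Lemma tens_bilin V W : bilin (@tens C V W).
Proof. by split=> [w|v] c x y; [rewrite linearPl | rewrite linearPr]. Qed.

(** [tsum] is a sum over one chosen representative of a tensor, so congruence,
    interchange and additive maps commute with it for arbitrary summands; only the
    evaluation at a tensor known explicitly needs bilinearity. *)
Lemma eq_tsum V W (X : nmodType) (F G : V -> W -> X) (t : tensor V W) :
  (forall v w, F v w = G v w) -> tsum F t = tsum G t.
Proof. by move=> h; apply: eq_bigr => p _; exact: h. Qed.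

Lemma tsumC V W U (U' : lmodType C) (X : nmodType) (F : V -> W -> U -> U' -> X)
    (t : tensor V W) (u : tensor U U') :
  tsum (fun a b => tsum (fun c d => F a b c d) u) t =
  tsum (fun c d => tsum (fun a b => F a b c d) t) u.
Proof. exact: exchange_big. Qed.

Lemma lin_tsum V W X U (f : X -> U) (F : V -> W -> X) t : lin f ->
  f (tsum F t) = tsum (fun a b => f (F a b)) t.
Proof. by move=> h; exact: lin_sum. Qed.

Lemma slin_tsum V W X (f : X -> C) (F : V -> W -> X) t : slin f ->
  f (tsum F t) = tsum (fun a b => f (F a b)) t.
Proof. exact: (@lin_tsum V W X C^o). Qed.

Lemma scale_tsum V W X c (F : V -> W -> X) t :
  c *: tsum F t = tsum (fun a b => c *: F a b) t.
Proof. exact: scaler_sumr. Qed.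

Lemma tsum_scale V W X (F : V -> W -> C) t (x : X) :
  tsum F t *: x = tsum (fun a b => F a b *: x) t.
Proof. exact: scaler_suml. Qed.

Lemma mul_tsum V W c (F : V -> W -> C) t :
  c * tsum F t = tsum (fun a b => c * F a b) t.
Proof. exact: mulr_sumr. Qed.

Lemma tsum_mul V W c (F : V -> W -> C) t :
  tsum F t * c = tsum (fun a b => F a b * c) t.
Proof. exact: mulr_suml. Qed.

Lemma tsum_tensE V W X (F : V -> W -> X) v w :
  (forall w, lin (fun v => F v w)) -> (forall v, lin (F v)) ->
  tsum F (tens v w) = F v w.
Proof. by move=> h1 h2; exact: tsum_tens_bil. Qed.

Lemma tsum_tensEs V W (F : V -> W -> C) v w :
  (forall w, slin (fun v => F v w)) -> (forall v, slin (F v)) ->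
  tsum F (tens v w) = F v w.
Proof. exact: (@tsum_tensE V W C^o). Qed.

Lemma lin_tsumt V W U X (F : V -> W -> X) (t : U -> tensor V W) :
  (forall w, lin (fun v => F v w)) -> (forall v, lin (F v)) -> lin t ->
  lin (fun x => tsum F (t x)).
Proof.
by move=> h1 h2 ht; apply: (@lin_comp _ _ _ (tsum F) t _ ht); apply: tsum_linear_bil.
Qed.

Lemma slin_tsumt V W U (F : V -> W -> C) (t : U -> tensor V W) :
  (forall w, slin (fun v => F v w)) -> (forall v, slin (F v)) -> lin t ->
  slin (fun x => tsum F (t x)).
Proof. exact: (@lin_tsumt V W U C^o). Qed.

Lemma lin_tsumF V W U X (F : U -> V -> W -> X) (t : tensor V W) :
  (forall v w, lin (fun u => F u v w)) -> lin (fun u => tsum (F u) t).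
Proof.
move=> h c u v; rewrite /tsum scaler_sumr -big_split.
by apply: eq_bigr => p _; exact: h.
Qed.

Lemma slin_tsumF V W U (F : U -> V -> W -> C) (t : tensor V W) :
  (forall v w, slin (fun u => F u v w)) -> slin (fun u => tsum (F u) t).
Proof. exact: (@lin_tsumF V W U C^o). Qed.

Lemma lin_scalel V X (f : V -> C) (x : X) : slin f -> lin (fun v => f v *: x).
Proof. by move=> h c u v; rewrite h scalerDl scalerA. Qed.

Lemma lin_scaler V X (f : V -> X) c : lin f -> lin (fun v => c *: f v).
Proof. by move=> h d u v; rewrite h scalerDr !scalerA mulrC. Qed.

Lemma slin_mull V (f : V -> C) c : slin f -> slin (fun v => f v * c).
Proof. by move=> h d u v; rewrite h mulrDl mulrA. Qed.

Lemma slin_mulr V (f : V -> C) c : slin f -> slin (fun v => c * f v).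
Proof. by move=> h d u v; rewrite h mulrDr !mulrA (mulrC c). Qed.

Lemma slin_bundled V (g : {scalar V}) : slin g.
Proof. by move=> c u v; rewrite linearP. Qed.
Lemma lin_bundled V X (g : {linear V -> X}) : lin g.
Proof. by move=> c u v; rewrite linearP. Qed.
Lemma bilin_bundled V W X (g : {bilinear V -> W -> X}) : bilin g.
Proof. by split=> [w|v] c x y; [rewrite linearPl | rewrite linearPr]. Qed.

Lemma tsum_tens_id V W (t : tensor V W) : tsum tens t = t.
Proof. by rewrite [RHS]tensor_span. Qed.

Lemma tsum_tsum V W V' W' X (F : V -> W -> X) (G : V' -> W' -> tensor V W) t :
  (forall w, lin (fun v => F v w)) -> (forall v, lin (F v)) ->
  tsum F (tsum G t) = tsum (fun a b => tsum F (G a b)) t.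
Proof. by move=> h1 h2; apply: (@lin_tsum _ _ _ _ (tsum F)); apply: tsum_linear_bil. Qed.

Lemma tsum_tsums V W V' W' (F : V -> W -> C) (G : V' -> W' -> tensor V W) t :
  (forall w, slin (fun v => F v w)) -> (forall v, slin (F v)) ->
  tsum F (tsum G t) = tsum (fun a b => tsum F (G a b)) t.
Proof. exact: (@tsum_tsum V W V' W' C^o). Qed.

Lemma tsumZ V W X (F : V -> W -> X) c (t : tensor V W) :
  (forall w, lin (fun v => F v w)) -> (forall v, lin (F v)) ->
  tsum F (c *: t) = c *: tsum F t.
Proof. by move=> h1 h2; apply: (@linZ _ _ (tsum F)); apply: tsum_linear_bil. Qed.

Lemma tensor_lin_ext V W X (f h : tensor V W -> X) : lin f -> lin h ->
  (forall v w, f (tens v w) = h (tens v w)) -> f =1 h.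
Proof.
move=> hf hh e t; rewrite (tensor_span t) !lin_sum//.
by apply: eq_bigr => p _; exact: e.
Qed.

(** An antilinear map into X is a linear map into the conjugate of X. *)
Lemma antiZ V X (f : V -> X) c v : antilinear f -> f (c *: v) = c^* *: f v.
Proof. exact: (@linZ V (conjv X)). Qed.

Lemma anti_tsum V W X U (f : X -> U) (F : V -> W -> X) t : antilinear f ->
  f (tsum F t) = tsum (fun a b => f (F a b)) t.
Proof. exact: (@lin_tsum V W X (conjv U)). Qed.

Lemma conj_tsum V W (F : V -> W -> C) (t : tensor V W) :
  (tsum F t)^* = tsum (fun a b => (F a b)^*) t.
Proof. exact: rmorph_sum. Qed.

End Linearity.
(** * Sweedler calculus *)

Section Coassociativity.
Context {C : numClosedFieldType} {A : hopfStarData C}.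

(** Both sides are the value of one linear map, the one induced by the trilinear F,
    at the two sides of the coassociativity axiom. *)
Lemma coassoc (M X : lmodType C) (delta : M -> tensor A M) (F : A -> A -> M -> X) m :
  is_comodule delta ->
  (forall b n, lin (fun a => F a b n)) -> (forall a n, lin (fun b => F a b n)) ->
  (forall a b, lin (F a b)) ->
  \tsum_(x, m0 <- delta m) \tsum_(a, b <- comul A x) F a b m0 =
  \tsum_(a, n <- delta m) \tsum_(b, m0 <- delta n) F a b m0.
Proof.
move=> hM h1 h2 h3.
pose L a (u : tensor A M) : X := \tsum_(b, m0 <- u) F a b m0.
have L1 u : lin (L^~ u) by apply: lin_tsumF => b n; exact: h1.
have L2 a : lin (L a) by exact: (@lin_tsumt _ _ _ _ _ (F a) id).
have Llin : lin (tsum L) by exact: (@lin_tsumt _ _ _ _ _ L id).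
have := congr1 (tsum L) (coactA hM m); rewrite !lin_tsum//.
rewrite (@eq_tsum _ _ _ _ _ (fun m1 m0 => \tsum_(a, b <- comul A m1) F a b m0)).
  move=> ->; apply: eq_tsum => a n; exact: tsum_tensE.
move=> x m0; rewrite lin_tsum//; apply: eq_tsum => a b.
by rewrite tsum_tensE// /L tsum_tensE.
Qed.

Lemma coassocs (M : lmodType C) (delta : M -> tensor A M) (F : A -> A -> M -> C) m :
  is_comodule delta ->
  (forall b n, slin (fun a => F a b n)) -> (forall a n, slin (fun b => F a b n)) ->
  (forall a b, slin (F a b)) ->
  \tsum_(x, m0 <- delta m) \tsum_(a, b <- comul A x) F a b m0 =
  \tsum_(a, n <- delta m) \tsum_(b, m0 <- delta n) F a b m0.
Proof. exact: (@coassoc M C^o). Qed.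

Lemma coact_counitE (M X : lmodType C) (delta : M -> tensor A M) (f : M -> X) m :
  is_comodule delta -> lin f ->
  \tsum_(a, n <- delta m) counit A a *: f n = f m.
Proof.
move=> hM hf; rewrite -[in RHS](coact_counit hM m) lin_tsum//.
by apply: eq_tsum => a n; rewrite linZ.
Qed.

Lemma coact_counitEs (M : lmodType C) (delta : M -> tensor A M) (f : M -> C) m :
  is_comodule delta -> slin f ->
  \tsum_(a, n <- delta m) (counit A a * f n) = f m.
Proof. exact: (@coact_counitE M C^o). Qed.

Hypothesis hA : is_hopf_star_algebra A.

Lemma comul_comodule : is_comodule (comul A).
Proof. by split; [exact: comul_linear | exact: comulA | exact: counitl]. Qed.

Lemma counit_rightE (X : lmodType C) (f : A -> X) a : lin f ->
  \tsum_(b, c <- comul A a) counit A c *: f b = f a.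
Proof.
move=> hf; rewrite -[in RHS](counitr hA a) lin_tsum//.
by apply: eq_tsum => b c; rewrite linZ.
Qed.

Lemma counit_rightEs (f : A -> C) a : slin f ->
  \tsum_(b, c <- comul A a) (counit A c * f b) = f a.
Proof. exact: (@counit_rightE C^o). Qed.

Lemma hmul_bilin : bilin (hmul A).
Proof. by split; [exact: (hmul_bilinear hA).1 | exact: (hmul_bilinear hA).2]. Qed.
Lemma comul_lin : lin (comul A). Proof. exact: comul_linear. Qed.
Lemma antipode_lin : lin (antipode A). Proof. exact: antipode_linear. Qed.
Lemma counit_slin : slin (counit A). Proof. exact: counit_linear. Qed.

End Coassociativity.

(** Proves linearity in one variable by following the syntax of the expression. For
    an operation with several arguments, the lemma for each argument is tried in
    turn: its unification succeeds only if the other arguments do not contain the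
    variable. The structure maps are recognized by the axioms present among the
    hypotheses. *)
Ltac mlin_step :=
  cbv beta;
  lazymatch goal with
  | |- forall _, _ => intro
  | |- bilin _ => first [assumption | apply: bilin_bundled | split => ?]
  | |- lin (fun x => x) => exact: lin_id
  | |- lin (fun x => tsum _ _) => first [apply: lin_tsumF | apply: lin_tsumt]
  | |- lin (fun x => tens _ _) =>
      first [apply: (lin_bil (@tens_bilin _ _ _)) | apply: (lin_bir (@tens_bilin _ _ _))]
  | |- lin (fun x => _ *: _) => first [apply: lin_scalel | apply: lin_scaler]
  | |- slin (fun x => tsum _ _) => first [apply: slin_tsumF | apply: slin_tsumt]
  | |- slin (fun x => _ * _) => first [apply: slin_mull | apply: slin_mulr]
  | |- _ => first
    [ assumption
    | match goal with
      | h : lin ?f |- lin (fun x => ?f _) => apply: (lin_comp h)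
      | h : lin ?f |- lin ?f => exact: h
      | h : slin ?f |- slin (fun x => ?f _) => apply: (slin_comp h)
      | h : bilin ?f |- lin (fun x => ?f _ _) =>
          first [apply: (lin_bil h) | apply: (lin_bir h)]
      | h : bilin ?f |- lin (?f ?w) => exact: (h.2 w)
      | h : is_hopf_star_algebra _ |- lin _ => first
        [ exact: (comul_lin h) | exact: (antipode_lin h) | exact: ((hmul_bilin h).2 _)
        | apply: (lin_bil (hmul_bilin h)) | apply: (lin_bir (hmul_bilin h))
        | apply: (lin_comp (comul_lin h)) | apply: (lin_comp (antipode_lin h)) ]
      | h : is_hopf_star_algebra _ |- slin _ => first
        [ exact: (counit_slin h) | apply: (slin_comp (counit_slin h)) ]
      | h : is_comodule ?d |- lin (fun x => ?d _) => apply: (lin_comp (coact_linear h))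
      | h : is_comodule ?d |- lin ?d => exact: (coact_linear h)
      end
    | exact: slin_bundled | exact: lin_bundled
    | exact: ((@tens_bilin _ _ _).2 _) | exact: ((@bilin_bundled _ _ _ _ _).2 _)
    | apply: (slin_comp (@slin_bundled _ _ _))
    | apply: (lin_comp (@lin_bundled _ _ _ _))
    | apply: (lin_bil (@bilin_bundled _ _ _ _ _))
    | apply: (lin_bir (@bilin_bundled _ _ _ _ _)) ]
  end.
Ltac mlin := solve [repeat mlin_step].

Ltac comod := first [ assumption
  | match goal with h : is_hopf_star_algebra _ |- is_comodule (comul _) =>
      exact: (comul_comodule h) end ].

(** Moves the sum over the coproduct or coaction of [x] in front of the sums that
    enclose it. *)
Ltac bubble x :=
  lazymatch goal with
  | |- tsum _ (_ x) = _ => reflexivity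
  | |- tsum _ _ = _ =>
    etransitivity;
    [ apply: eq_tsum; let a := fresh "a" in let b := fresh "b" in
      intros a b; cbv beta; bubble x; reflexivity
    | cbv beta; apply: tsumC ]
  end.

(** Rewrites a coproduct into a sum; extended below by the coproducts of products
    and antipodes. *)
Ltac coproduct_rule := fail.

(** Normal form of nested Sweedler sums: a sum over an explicit tensor is evaluated,
    a splitting of the left leg is moved to the right by coassociativity, and the
    splittings descending from one element are made consecutive, so that each element
    contributes its iterated coproduct in right-nested form. *)
Ltac comb :=
  cbv beta;
  lazymatch goal with
  | |- tsum _ (tsum _ _) = _ =>
    etransitivity; [first [apply: tsum_tsum; mlin | apply: tsum_tsums; mlin] | comb]
  | |- tsum _ (tens _ _) = _ =>
    etransitivity; [first [apply: tsum_tensE; mlin | apply: tsum_tensEs; mlin] | comb]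
  | |- tsum ?F ?t = _ => first
    [ etransitivity; [ apply: (congr1 (tsum F)); coproduct_rule | comb ]
    | etransitivity;
      [ apply: eq_tsum; let a := fresh "a" in let b := fresh "b" in
        intros a b; cbv beta; bubble a; reflexivity
      | cbv beta; etransitivity;
        [first [apply: coassoc; [comod | mlin | mlin | mlin]
               |apply: coassocs; [comod | mlin | mlin | mlin]] | comb]]
    | etransitivity;
      [ apply: eq_tsum; let a := fresh "a" in let b := fresh "b" in
        intros a b; cbv beta; bubble b; reflexivity
      | cbv beta; comb_under ]
    | comb_under ]
  | |- _ => reflexivity
  end
with comb_under :=
  apply: eq_tsum; let a := fresh "a" in let b := fresh "b" in
  intros a b; comb.

(** Equates nested Sweedler sums with the same normal form. The second pass treats
    the splittings that only appear when the coproduct of a product or of an antipode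
    is expanded. *)
Ltac sweedler :=
  etransitivity; [comb | etransitivity; [comb |]];
  symmetry;
  etransitivity; [comb | etransitivity; [comb |]];
  cbv beta; repeat (apply: eq_tsum; intros ? ?; cbv beta);
  try first [reflexivity | ring].

(** * Convolution and the antipode *)

Section Convolution.
Context {C : numClosedFieldType} {A : hopfStarData C} (hA : is_hopf_star_algebra A).
Context {X : lmodType C} (mul : X -> X -> X) (one : X).
Hypothesis mul_bil : bilin mul.
Hypothesis mulA : associative mul.
Hypothesis mul1 : left_id one mul.
Hypothesis mulr1 : right_id one mul.
Notation D := (comul A).
Implicit Types f g h : A -> A -> X.

Definition conv2 f g (a b : A) : X :=
  \tsum_(a1, a2 <- D a) \tsum_(b1, b2 <- D b) mul (f a1 b1) (g a2 b2).

Definition conv2_unit (a b : A) : X := (counit A a * counit A b) *: one.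

Lemma conv2_bilin f g : bilin f -> bilin g -> bilin (conv2 f g).
Proof. by move=> hf hg; split=> ?; rewrite /conv2; mlin. Qed.

Lemma conv2A f g h : bilin f -> bilin g -> bilin h ->
  forall a b, conv2 (conv2 f g) h a b = conv2 f (conv2 g h) a b.
Proof.
move=> hf hg hh a b; rewrite /conv2.
under eq_tsum => x y.
  under eq_tsum => k l.
    rewrite (lin_tsum _ _ (mul_bil.1 _)).
    under eq_tsum do rewrite (lin_tsum _ _ (mul_bil.1 _)).
  over.
over.
under [RHS]eq_tsum => x y.
  under eq_tsum => k l.
    rewrite (lin_tsum _ _ (mul_bil.2 _)).
    under eq_tsum do rewrite (lin_tsum _ _ (mul_bil.2 _)).
  over.
over.
cbv beta.
sweedler.
by rewrite mulA.
Qed.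

Lemma conv2_unitl f : bilin f -> forall a b, conv2 conv2_unit f a b = f a b.
Proof.
move=> hf a b; rewrite /conv2 /conv2_unit.
under eq_tsum => x y.
  under eq_tsum do rewrite (linZ _ _ (mul_bil.1 _)) mul1 -scalerA.
  rewrite -scale_tsum (coact_counitE _ (comul_comodule hA) (hf.2 _)).
over.
by rewrite (coact_counitE _ (comul_comodule hA) (hf.1 _)).
Qed.

Lemma conv2_unitr f : bilin f -> forall a b, conv2 f conv2_unit a b = f a b.
Proof.
move=> hf a b; rewrite /conv2 /conv2_unit.
under eq_tsum => x y.
  under eq_tsum do rewrite (linZ _ _ (mul_bil.2 _)) mulr1 -scalerA.
  rewrite -scale_tsum (counit_rightE hA _ (hf.2 _)).
over.
by rewrite (counit_rightE hA _ (hf.1 _)).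
Qed.

Lemma eq_conv2 f f' g g' : (forall a b, f a b = f' a b) ->
  (forall a b, g a b = g' a b) -> forall a b, conv2 f g a b = conv2 f' g' a b.
Proof.
by move=> hf hg a b; apply: eq_tsum => x y; apply: eq_tsum => k l; rewrite hf hg.
Qed.

(** f = f * (g * h) = (f * g) * h = h. Every identity below that compares two
    inverses of one map is an instance; functions of one variable are treated by
    letting the counit act on the second. *)
Lemma conv2_inv_uniq f g h : bilin f -> bilin g -> bilin h ->
  (forall a b, conv2 f g a b = conv2_unit a b) ->
  (forall a b, conv2 g h a b = conv2_unit a b) ->
  forall a b, f a b = h a b.
Proof.
move=> hf hg hh fg gh a b.
rewrite -(conv2_unitr hf) -(conv2_unitl hh).
rewrite -(eq_conv2 (fun _ _ => erefl) gh) -(eq_conv2 fg (fun _ _ => erefl)).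
by rewrite conv2A.
Qed.

End Convolution.

Section HopfIdentities.
Context {C : numClosedFieldType} {A : hopfStarData C} (hA : is_hopf_star_algebra A).
Notation S := (antipode A).
Notation D := (comul A).
Notation eps := (counit A).
Notation one := (hone A).
Notation "a ⋅ b" := (hmul A a b) (at level 40, left associativity).

Lemma antipodelE (X : lmodType C) (f : A -> X) a : lin f ->
  \tsum_(x, y <- D a) f (S x ⋅ y) = eps a *: f one.
Proof. by move=> hf; rewrite -lin_tsum// (antipodel hA) linZ. Qed.
Lemma antipodelEs (f : A -> C) a : slin f ->
  \tsum_(x, y <- D a) f (S x ⋅ y) = eps a * f one.
Proof. exact: (@antipodelE C^o). Qed.
Lemma antipoderE (X : lmodType C) (f : A -> X) a : lin f ->
  \tsum_(x, y <- D a) f (x ⋅ S y) = eps a *: f one.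
Proof. by move=> hf; rewrite -lin_tsum// (antipoder hA) linZ. Qed.
Lemma antipoderEs (f : A -> C) a : slin f ->
  \tsum_(x, y <- D a) f (x ⋅ S y) = eps a * f one.
Proof. exact: (@antipoderE C^o). Qed.

Lemma antipode1 : S one = one.
Proof.
have := antipodel hA one; rewrite (comul1 hA) tsum_tensE; [|mlin|mlin].
by rewrite (hmulr1 hA) (counit1 hA) scale1r.
Qed.

(** Both sides are convolution inverses of the product of A. *)
Lemma antipodeM a b : S (a ⋅ b) = S b ⋅ S a.
Proof.
move: a b; apply: (@conv2_inv_uniq _ _ hA _ (hmul A) one (hmul_bilin hA)
  (hmulA hA) (hmul1 hA) (hmulr1 hA) _ (hmul A)).
- by split=> ?; mlin.
- exact: hmul_bilin.
- by split=> ?; mlin.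
- move=> a b; rewrite /conv2 /conv2_unit -(counitM hA) -(antipodel hA) (comulM hA).
  symmetry; etransitivity; first by comb.
  by symmetry; comb.
- move=> a b; rewrite /conv2 /conv2_unit.
  under eq_tsum => x y.
    under eq_tsum do rewrite -(hmulA hA) (hmulA hA _ (S _)).
    rewrite (antipoderE (f := fun z => x ⋅ (z ⋅ S y))); last by mlin.
    rewrite (hmul1 hA).
  over.
  by rewrite -scale_tsum antipoder// scalerA mulrC.
Qed.

Definition tmul (u v : tensor A A) : tensor A A :=
  \tsum_(p, q <- u) \tsum_(r, s <- v) tens (p ⋅ r) (q ⋅ s).

Lemma tmul_bilin : bilin tmul.
Proof. by split=> ?; rewrite /tmul; mlin. Qed.

Lemma tmul_tens p q r s : tmul (tens p q) (tens r s) = tens (p ⋅ r) (q ⋅ s).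
Proof. by rewrite /tmul; comb. Qed.

Lemma tmulA : associative tmul.
Proof.
have hm := tmul_bilin.
move=> u v w; move: u; apply: tensor_lin_ext; [mlin|mlin|move=> a a'].
move: v; apply: tensor_lin_ext; [mlin|mlin|move=> b b'].
move: w; apply: tensor_lin_ext; [mlin|mlin|move=> c c'].
by rewrite !tmul_tens !(hmulA hA).
Qed.

Lemma tmul1 : left_id (tens one one) tmul.
Proof.
have hm := tmul_bilin; apply: tensor_lin_ext; [mlin|mlin|move=> a a'].
by rewrite tmul_tens !(hmul1 hA).
Qed.

Lemma tmulr1 : right_id (tens one one) tmul.
Proof.
have hm := tmul_bilin; apply: tensor_lin_ext; [mlin|mlin|move=> a a'].
by rewrite tmul_tens !(hmulr1 hA).
Qed.

(** Both sides are convolution inverses of the coproduct, in the maps from A to the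
    algebra A (x) A. *)
Lemma comul_antipode a : D (S a) = \tsum_(x, y <- D a) tens (S y) (S x).
Proof.
have hm := tmul_bilin.
have counit_split b : \tsum_(b1, b2 <- D b) (eps b1 * eps b2) = eps b.
  by apply: (coact_counitEs (f := eps)); [exact: comul_comodule | mlin].
pose f a b := eps b *: D (S a).
pose h a b := eps b *: \tsum_(x, y <- D a) tens (S y) (S x).
pose k a b := eps b *: D a.
suff : forall a b, f a b = h a b.
  by move=> /(_ a one); rewrite /f /h (counit1 hA) !scale1r.
have reduce (F G : A -> tensor A A) : lin F -> lin G -> forall a b,
    conv2 tmul (fun a b => eps b *: F a) (fun a b => eps b *: G a) a b =
    eps b *: \tsum_(x, y <- D a) tmul (F x) (G y).
  move=> hF hG c b; rewrite /conv2 scale_tsum; apply: eq_tsum => x y.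
  under eq_tsum do rewrite (linZ _ _ (hm.1 _)) (linZ _ _ (hm.2 _)) scalerA.
  by rewrite -tsum_scale counit_split.
apply: (@conv2_inv_uniq _ _ hA _ tmul (tens one one) hm tmulA tmul1 tmulr1 _ k).
- by split=> ?; rewrite /f; mlin.
- by split=> ?; rewrite /k; mlin.
- by split=> ?; rewrite /h; mlin.
- move=> c b; rewrite reduce /conv2_unit; [|mlin|mlin].
  under eq_tsum do rewrite -[tmul _ _](comulM hA).
  rewrite (antipodelE (f := D)); last by mlin.
  by rewrite (comul1 hA) scalerA mulrC.
- move=> c b; rewrite reduce /conv2_unit; [|mlin|mlin].
  rewrite mulrC -scalerA; congr (_ *: _); rewrite /tmul.
  transitivity (\tsum_(p, z <- D c) \tsum_(w, s <- D z) \tsum_(q, r <- D w)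
    tens (p ⋅ S s) (q ⋅ S r)); first by sweedler.
  under eq_tsum => p z.
    under eq_tsum => w s.
      rewrite (antipoderE (f := tens (p ⋅ S s))); last by mlin.
    over.
    rewrite (coact_counitE (f := fun s => tens (p ⋅ S s) one)); [|comod|mlin].
  over.
  by rewrite (antipoderE (f := fun z => tens z one))//; mlin.
Qed.

Lemma antipode_invK a : S (antipode_inv a) = a.
Proof.
have [T ST TS] := antipode_bij hA.
rewrite /antipode_inv; apply: (@xgetPex _ 0 [set b | S b = a]%classic).
by exists (T a); exact: TS.
Qed.

Lemma antipode_inj : injective S.
Proof. exact: bij_inj (antipode_bij hA). Qed.

Lemma antipodeK a : antipode_inv (S a) = a.
Proof. by apply: antipode_inj; rewrite antipode_invK. Qed.

Lemma counit_antipode a : eps (S a) = eps a.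
Proof.
have := congr1 eps (antipodel hA a).
rewrite (slinZ _ _ (counit_slin hA)) (counit1 hA) mulr1 => <-.
rewrite (slin_tsum _ _ (counit_slin hA)).
under eq_tsum do rewrite (counitM hA) mulrC.
by rewrite (counit_rightEs hA (f := fun x => eps (S x)))//; mlin.
Qed.

Lemma hstar1 : hstar A one = one.
Proof.
have h x : hstar A one ⋅ x = x.
  by rewrite -[x in LHS](hstarK hA) -(hstarM hA) (hmulr1 hA) (hstarK hA).
by rewrite -[LHS](hmulr1 hA) h.
Qed.

Lemma tsum_comul_star (X : lmodType C) (F : A -> A -> X) a :
  (forall b, lin (F^~ b)) -> (forall b, lin (F b)) ->
  \tsum_(x, y <- D (hstar A a)) F x y = \tsum_(x, y <- D a) F (hstar A x) (hstar A y).
Proof.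
move=> h1 h2; rewrite (comul_star hA) tsum_tsum//.
by apply: eq_tsum => x y; rewrite tsum_tensE.
Qed.

Lemma tsum_comul_stars (F : A -> A -> C) a :
  (forall b, slin (F^~ b)) -> (forall b, slin (F b)) ->
  \tsum_(x, y <- D (hstar A a)) F x y = \tsum_(x, y <- D a) F (hstar A x) (hstar A y).
Proof. exact: (@tsum_comul_star C^o). Qed.

(** The conjugate of the counit is a left counit too, hence equal to it. *)
Lemma counit_star a : eps (hstar A a) = (eps a)^*.
Proof.
have hst := hstar_antilinear hA.
pose e (x : A) : C := (eps (hstar A x))^*.
have e_lin : slin e.
  move=> c u v; rewrite /e hst (counit_linear hA) rmorphD rmorphM.
  by rewrite [X in X * _](conjCK c).
have e_unit b : \tsum_(x, y <- D b) e x *: y = b.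
  rewrite -(hstarK hA b); set c := hstar A b.
  rewrite tsum_comul_star; [|mlin|mlin].
  rewrite -[in RHS](counitl hA c) anti_tsum//.
  by apply: eq_tsum => x y; rewrite /e (hstarK hA) antiZ.
have -> : (eps a)^* = e (hstar A a) by rewrite /e (hstarK hA).
rewrite -[in LHS](e_unit (hstar A a)) (slin_tsum _ _ (counit_slin hA)).
under eq_tsum do rewrite (slinZ _ _ (counit_slin hA)) mulrC.
by rewrite (counit_rightEs hA).
Qed.

(** T(x) = S(x^* )^* satisfies T(x_(2)) x_(1) = eps(x), being a conjugate of the
    antipode axiom. Applying S shows that S T is convolution inverse to S, like the
    identity; so S T = id, and T(a^* ) = S(a)^*. *)
Lemma antipode_star a : S (hstar A (S a)) = hstar A a.
Proof.
have hst := hstar_antilinear hA.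
pose T (x : A) := hstar A (S (hstar A x)).
have T_lin : lin T by move=> c u v; rewrite /T hst (antipode_lin hA) hst conjCK.
have T_skew b : \tsum_(x, y <- D b) T y ⋅ x = eps b *: one.
  rewrite -(hstarK hA b); set c := hstar A b.
  rewrite tsum_comul_star; [|mlin|mlin].
  transitivity (hstar A (\tsum_(x, y <- D c) x ⋅ S y)).
    rewrite anti_tsum//; apply: eq_tsum => x y.
    by rewrite /T (hstarM hA) (hstarK hA).
  by rewrite (antipoder hA) antiZ// hstar1 (counit_star c).
suff ST b : S (T b) = b by rewrite -[in LHS](hstarK hA a) -/(T _) ST.
transitivity (\tsum_(x, y <- D b) \tsum_(p, q <- D y) x ⋅ (S p ⋅ S (T q))).
  transitivity (\tsum_(z, q <- D b) \tsum_(x, p <- D z) (x ⋅ S p ⋅ S (T q))).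
    under [RHS]eq_tsum => z q.
      rewrite (antipoderE (f := fun v => v ⋅ S (T q))); last by mlin.
      rewrite (hmul1 hA).
    over.
    by rewrite (coact_counitE (f := fun q => S (T q)))//; [comod|mlin].
  by sweedler; rewrite (hmulA hA).
transitivity (\tsum_(x, y <- D b) eps y *: x); last exact: (counitr hA).
apply: eq_tsum => x y.
under eq_tsum do rewrite -antipodeM.
transitivity (x ⋅ S (\tsum_(p, q <- D y) T q ⋅ p)).
  rewrite (lin_tsum _ _ (antipode_lin hA)).
  by rewrite (lin_tsum _ _ ((hmul_bilin hA).2 x)).
rewrite T_skew (linZ _ _ (antipode_lin hA)) antipode1.
by rewrite (linZ _ _ ((hmul_bilin hA).2 x)) (hmulr1 hA).
Qed.

Lemma antipode_inv_star a : antipode_inv (hstar A a) = hstar A (S a).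
Proof. by apply: antipode_inj; rewrite antipode_invK antipode_star. Qed.

Lemma antipode_inv_lin : lin (@antipode_inv C A).
Proof.
by move=> c u v; apply: antipode_inj; rewrite (antipode_lin hA) !antipode_invK.
Qed.

End HopfIdentities.

Ltac coproduct_rule ::=
  match goal with h : is_hopf_star_algebra _ |- _ => first
  [ exact: (comulM h) | exact: (comul_antipode h) | exact: (comul1 h) ] end.

(** * Products deformed by a cocycle *)

Section TwistedProductDef.
Context {C : numClosedFieldType} {A : hopfStarData C}.
Context {M N Q : lmodType C} (g : {scalar tensor A A}).
Context (dM : M -> tensor A M) (dN : N -> tensor A N) (dQ : Q -> tensor A Q).

(** The product and actions in [twist_comod] and [Gamma] are instances. *)
Definition twist_prod (mu : M -> N -> Q) m n : Q :=
  \tsum_(m1, m0 <- dM m) \tsum_(n1, n0 <- dN n) g (tens m1 n1) *: mu m0 n0.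

Definition colinear2 (mu : M -> N -> Q) := forall m n, dQ (mu m n) =
  \tsum_(m1, m0 <- dM m) \tsum_(n1, n0 <- dN n) tens (hmul A m1 n1) (mu m0 n0).

Lemma twist_prod_bilin mu : lin dM -> lin dN -> bilin mu -> bilin (twist_prod mu).
Proof. by move=> hM hN hmu; split=> ?; rewrite /twist_prod; mlin. Qed.

End TwistedProductDef.
Arguments twist_prod {C A M N Q} g dM dN mu m n.

(** * Identities for U, V and the cocycle *)

Section Cocycle.
Context {C : numClosedFieldType} {A : hopfStarData C} (hA : is_hopf_star_algebra A).
Context (g gbar : {scalar tensor A A}) (hg : is_unitary_2cocycle g gbar).
Notation S := (antipode A).
Notation D := (comul A).
Notation eps := (counit A).
Notation one := (hone A).
Notation "a ⋅ b" := (hmul A a b) (at level 40, left associativity).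
Notation U := (cocU g).
Notation Ubar := (cocUbar gbar).
Notation V := (cocV g).
Notation Vbar := (cocVbar gbar).

Lemma cocU_slin : slin U. Proof. by rewrite /cocU; mlin. Qed.
Lemma cocUbar_slin : slin Ubar. Proof. by rewrite /cocUbar; mlin. Qed.
Lemma cocV_slin : slin V.
Proof. exact: (slin_comp cocU_slin (antipode_inv_lin hA)). Qed.
Lemma cocVbar_slin : slin Vbar.
Proof. exact: (slin_comp cocUbar_slin (antipode_inv_lin hA)). Qed.
Let hU := cocU_slin.
Let hUbar := cocUbar_slin.

(** The cocycle identity for a_(1), S(a_(2)), k: on its other side the first factor
    becomes U and the second is evaluated at a_(2) S(a_(3)). *)
Lemma cocycle_antipode a k :
  \tsum_(a1, x <- D a) \tsum_(a2, a3 <- D x) \tsum_(k1, k2 <- D k)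
    (g (tens (S a3) k1) * g (tens a1 (S a2 ⋅ k2))) = U a * eps k.
Proof.
transitivity (\tsum_(a1, x <- D a) \tsum_(b1, b2 <- D (S x)) \tsum_(k1, k2 <- D k)
    (g (tens b1 k1) * g (tens a1 (b2 ⋅ k2)))); first by sweedler.
under eq_tsum do rewrite -(cocycleP hg).
transitivity (\tsum_(p, z <- D a) \tsum_(w, s <- D z) \tsum_(q, r <- D w)
  (g (tens p (S s)) * g (tens (q ⋅ S r) k))); first by sweedler.
rewrite /cocU tsum_mul; apply: eq_tsum => p z.
under eq_tsum => w s.
  rewrite (antipoderEs hA (f := fun v => g (tens p (S s)) * g (tens v k))); last by mlin.
  rewrite (cocycle1l hg).
over.
by rewrite (coact_counitEs (f := fun s => g (tens p (S s)) * eps k))//; [comod|mlin].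
Qed.

(** Multiply [cocycle_antipode] on the left by gbar(S(a), k). *)
Lemma cocycle_antipode_inv a k :
  \tsum_(a1, a2 <- D a) g (tens a1 (S a2 ⋅ k)) =
  \tsum_(a1, a2 <- D a) (U a1 * gbar (tens (S a2) k)).
Proof.
symmetry.
transitivity (\tsum_(x, y <- D a) \tsum_(k0, k' <- D k)
    (gbar (tens (S y) k0) * (U x * eps k'))).
  apply: eq_tsum => x y; under [RHS]eq_tsum do rewrite mulrA mulrC.
  by rewrite (counit_rightEs hA) 1?mulrC//; mlin.
under eq_tsum => x y.
  under eq_tsum => k0 k'.
    rewrite -cocycle_antipode mul_tsum.
    under eq_tsum => a1 x'.
      rewrite mul_tsum; under eq_tsum do rewrite mul_tsum.
    over.
  over.
over.
transitivity (\tsum_(a1, t <- D a) \tsum_(a2, u <- D t) \tsum_(l, k2 <- D k)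
    \tsum_(b1, b2 <- D (S u)) \tsum_(l1, l2 <- D l)
    (gbar (tens b1 l1) * g (tens b2 l2) * g (tens a1 (S a2 ⋅ k2)))).
  sweedler.
under eq_tsum => a1 t.
  under eq_tsum => a2 u.
    under eq_tsum => l k2.
      under eq_tsum do rewrite -tsum_mul.
      rewrite -tsum_mul (cocycle_invl hg).
    over.
  over.
over.
transitivity (\tsum_(a1, t <- D a) \tsum_(a2, u <- D t) \tsum_(l, k2 <- D k)
    (eps u * (eps l * g (tens a1 (S a2 ⋅ k2))))).
  by do 3!apply: eq_tsum => ? ?; rewrite (counit_antipode hA) mulrA.
apply: eq_tsum => a1 t.
transitivity (\tsum_(a2, u <- D t) (eps u * g (tens a1 (S a2 ⋅ k)))).
  apply: eq_tsum => a2 u; rewrite -mul_tsum; congr (_ * _).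
  by rewrite (coact_counitEs (f := fun k => g (tens a1 (S a2 ⋅ k))))//; [comod|mlin].
by rewrite (counit_rightEs hA (f := fun a2 => g (tens a1 (S a2 ⋅ k))))//; mlin.
Qed.

(** [cocycle_antipode_inv] with k the last leg of a. *)
Lemma cocU_Ubar a : \tsum_(x, y <- D a) (U x * Ubar y) = eps a.
Proof.
transitivity (\tsum_(z, q <- D a) \tsum_(x, p <- D z) (U x * gbar (tens (S p) q))).
  rewrite /cocUbar; under eq_tsum do rewrite mul_tsum.
  by sweedler.
under eq_tsum do rewrite -cocycle_antipode_inv.
transitivity (\tsum_(x, y <- D a) \tsum_(p, q <- D y) g (tens x (S p ⋅ q))).
  by sweedler.
under eq_tsum => x y.
  rewrite (antipodelEs hA (f := fun v => g (tens x v))); last by mlin.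
  rewrite (cocycle1r hg).
over.
by rewrite (counit_rightEs hA)//; mlin.
Qed.

Lemma conj_g a b : (g (tens a b))^* =
  gbar (tens (antipode_inv (hstar A a)) (antipode_inv (hstar A b))).
Proof. by rewrite (cocycle_unitary hg) !(antipode_inv_star hA). Qed.

Lemma conj_gbar a b : (gbar (tens a b))^* =
  g (tens (hstar A (S a)) (hstar A (S b))).
Proof.
apply: (can_inj (@conjCK C)); rewrite conjCK (cocycle_unitary hg).
by rewrite !(antipode_star hA) !(hstarK hA).
Qed.

Lemma comul_antipode_inv a :
  D (antipode_inv a) = \tsum_(x, y <- D a) tens (antipode_inv y) (antipode_inv x).
Proof.
have hi := antipode_inv_lin hA.
rewrite -[a in RHS](antipode_invK hA) (comul_antipode hA).
rewrite tsum_tsum; [|mlin|mlin].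
rewrite -[LHS]tsum_tens_id.
apply: eq_tsum => x y; rewrite tsum_tensE; [|mlin|mlin].
by rewrite !(antipodeK hA).
Qed.

Lemma cocVE a : V a = \tsum_(x, y <- D a) g (tens (antipode_inv y) x).
Proof.
have hi := antipode_inv_lin hA.
rewrite /cocV /cocU comul_antipode_inv tsum_tsums; [|mlin|mlin].
by apply: eq_tsum => x y; rewrite tsum_tensEs ?(antipode_invK hA)//; mlin.
Qed.

Lemma cocVbarE a : Vbar a = \tsum_(x, y <- D a) gbar (tens y (antipode_inv x)).
Proof.
have hi := antipode_inv_lin hA.
rewrite /cocVbar /cocUbar comul_antipode_inv tsum_tsums; [|mlin|mlin].
by apply: eq_tsum => x y; rewrite tsum_tensEs ?(antipode_invK hA)//; mlin.
Qed.

Lemma conj_Vbar a : (Vbar (hstar A a))^* = V a.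
Proof.
have hi := antipode_inv_lin hA.
rewrite cocVbarE cocVE (tsum_comul_stars hA); [|mlin|mlin].
rewrite conj_tsum; apply: eq_tsum => x y.
by rewrite conj_gbar (antipode_invK hA) (hstarK hA) -(antipode_inv_star hA) (hstarK hA).
Qed.

Lemma cocVbar_V a : \tsum_(x, y <- D a) (Vbar x * V y) = eps a.
Proof.
have hi := antipode_inv_lin hA.
rewrite -[in RHS](antipode_invK hA a) (counit_antipode hA) -cocU_Ubar.
rewrite comul_antipode_inv tsum_tsums; [|mlin|mlin].
by apply: eq_tsum => x y; rewrite tsum_tensEs 1?mulrC//; mlin.
Qed.

(** The complex conjugate of [cocVbar_V]: for a unitary cocycle, conjugation together
    with the involution interchanges V and Vbar. *)
Lemma cocV_Vbar a : \tsum_(x, y <- D a) (V x * Vbar y) = eps a.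
Proof.
have hV := cocV_slin; have hVb := cocVbar_slin.
rewrite -[RHS]conjCK -(counit_star hA) -cocVbar_V (tsum_comul_stars hA); [|mlin|mlin].
rewrite conj_tsum; apply: eq_tsum => x y; rewrite rmorphM /= conj_Vbar.
by congr (_ * _); rewrite -conj_Vbar conjCK (hstarK hA).
Qed.

Lemma cocUbar_U a : \tsum_(x, y <- D a) (Ubar x * U y) = eps a.
Proof.
have hV := cocV_slin; have hVb := cocVbar_slin.
rewrite -(counit_antipode hA) -cocV_Vbar (comul_antipode hA) tsum_tsums; [|mlin|mlin].
apply: eq_tsum => x y; rewrite tsum_tensEs; [|mlin|mlin].
by rewrite /cocV /cocVbar !(antipodeK hA) mulrC.
Qed.

(** The functionals of two variables in the next identities; [conv2s] is their
    convolution. *)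
Let conv2s (f h : A -> A -> C) : A -> A -> C := @conv2 C A C^o *%R f h.

Let gf (a b : A) : C := g (tens a b).
Let gbf (a b : A) : C := gbar (tens a b).
Let Um (a b : A) : C := U (a ⋅ b).
Let Ubm (a b : A) : C := Ubar (a ⋅ b).
Let gS (a b : A) : C := g (tens (S b) (S a)).

(** The left side is g(a_(1), b_(1)) g(a_(2) b_(2), S(a_(3) b_(3))) g(S(b_(4)), S(a_(4))).
    Applied to the first two factors, the cocycle identity brings b_(2) next to
    S(b_(3)); after their cancellation there is U of one leg of a times the left side
    of [cocycle_antipode] for b and k the antipode of the other leg. *)
Lemma cocU_mul a b : conv2s gf (conv2s Um gS) a b = U a * U b.
Proof.
rewrite /conv2s /conv2 /gf /Um /gS {1}/cocU.
transitivity (\tsum_(w, z <- D a) \tsum_(v, u <- D b) \tsum_(a3, a4 <- D z)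
  \tsum_(b3, b4 <- D u) ((\tsum_(a1, a2 <- D w) \tsum_(b1, b2 <- D v)
    (g (tens a1 b1) * g (tens (a2 ⋅ b2) (S b3 ⋅ S a3)))) * g (tens (S b4) (S a4)))).
  under eq_tsum => x y.
    under eq_tsum => x' y'.
      rewrite mul_tsum; under eq_tsum => p q.
        rewrite mul_tsum; under eq_tsum do rewrite tsum_mul mul_tsum.
      over.
    over.
  over.
  under [RHS]eq_tsum => w z.
    under eq_tsum => v u.
      under eq_tsum => a3 a4.
        under eq_tsum => b3 b4.
          rewrite tsum_mul; under eq_tsum do rewrite tsum_mul.
        over.
      over.
    over.
  over.
  cbv beta; sweedler.
  by rewrite (antipodeM hA) mulrA.
under eq_tsum do under eq_tsum do under eq_tsum do under eq_tsum do
  rewrite (cocycleP hg).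
transitivity (\tsum_(a1, z <- D a) \tsum_(b1, t <- D b) \tsum_(m, n <- D t)
  \tsum_(b4, b5 <- D n) \tsum_(a2, y <- D z) \tsum_(a3, a4 <- D y)
  \tsum_(b2, b3 <- D m) (g (tens b1 (S b4 ⋅ S a3)) *
    g (tens a1 (b2 ⋅ S b3 ⋅ S a2)) * g (tens (S b5) (S a4)))).
  under eq_tsum => w z.
    under eq_tsum => v u.
      under eq_tsum => a3 a4.
        under eq_tsum => b3 b4.
          rewrite tsum_mul; under eq_tsum do rewrite tsum_mul.
        over.
      over.
    over.
  over.
  cbv beta; sweedler.
  by rewrite (hmulA hA).
transitivity (\tsum_(w, y <- D a) \tsum_(a1, a2 <- D w) (g (tens a1 (S a2)) *
  (\tsum_(b1, t <- D b) \tsum_(b4, b5 <- D t) \tsum_(k1, k2 <- D (S y))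
     (g (tens (S b5) k1) * g (tens b1 (S b4 ⋅ k2)))))).
  transitivity (\tsum_(a1, z <- D a) \tsum_(b1, n <- D b)
    \tsum_(b4, b5 <- D n) \tsum_(a2, y <- D z) \tsum_(a3, a4 <- D y)
    (g (tens b1 (S b4 ⋅ S a3)) * g (tens a1 (S a2)) * g (tens (S b5) (S a4)))).
    apply: eq_tsum => a1 z; apply: eq_tsum => b1 t.
    under eq_tsum => m n.
      under eq_tsum => b4 b5.
        under eq_tsum => a2 y.
          under eq_tsum => a3 a4.
            rewrite (antipoderEs hA (f := fun v => g (tens b1 (S b4 ⋅ S a3)) *
              g (tens a1 (v ⋅ S a2)) * g (tens (S b5) (S a4)))); last by mlin.
            rewrite (hmul1 hA).
          over.
          rewrite -mul_tsum.
        over.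
        rewrite -mul_tsum.
      over.
      rewrite -mul_tsum.
    over.
    by rewrite (coact_counitEs (f := fun n => \tsum_(b4, b5 <- D n) \tsum_(a2, y <- D z)
      \tsum_(a3, a4 <- D y) (g (tens b1 (S b4 ⋅ S a3)) * g (tens a1 (S a2)) *
      g (tens (S b5) (S a4)))))//; [comod|mlin].
  under [RHS]eq_tsum => w y.
    under eq_tsum => a1 a2.
      rewrite mul_tsum; under eq_tsum => b1 t.
        rewrite mul_tsum; under eq_tsum do rewrite mul_tsum.
      over.
    over.
  over.
  cbv beta; sweedler.
under eq_tsum do under eq_tsum do rewrite cocycle_antipode (counit_antipode hA).
under eq_tsum do rewrite -tsum_mul -/(cocU g _).
under eq_tsum do rewrite mulrC -mulrA.
rewrite -mul_tsum mulrC; congr (_ * _).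
by rewrite (counit_rightEs hA).
Qed.

Lemma cocU_conv a b : conv2s (fun a b => U a * U b) (fun a b => Ubar a * Ubar b) a b =
  eps a * eps b.
Proof.
rewrite /conv2s /conv2 -cocU_Ubar tsum_mul; apply: eq_tsum => x y.
rewrite -cocU_Ubar mul_tsum; apply: eq_tsum => p q.
by rewrite mulrACA.
Qed.

(** Both sides are convolution inverses of g * (U o m): the left one since gbar and
    Ubar are inverses of g and U, the right one by [cocU_mul]. *)
Lemma cocUbar_mul a b : conv2s Ubm gbf a b = conv2s gS (fun a b => Ubar a * Ubar b) a b.
Proof.
have mb : @bilin C C^o C^o C^o *%R.
  by split=> w c x y; rewrite /= /GRing.scale /=; ring.
have bil (f : A -> A -> C) : (forall b, slin (fun a => f a b)) ->
    (forall a, slin (f a)) -> @bilin C A A C^o f by [].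
have gf_bil : @bilin C A A C^o gf by apply: bil => ?; rewrite /gf; mlin.
have gbf_bil : @bilin C A A C^o gbf by apply: bil => ?; rewrite /gbf; mlin.
have gS_bil : @bilin C A A C^o gS by apply: bil => ?; rewrite /gS; mlin.
have Um_bil : @bilin C A A C^o Um by apply: bil => ?; rewrite /Um; mlin.
have Ubm_bil : @bilin C A A C^o Ubm by apply: bil => ?; rewrite /Ubm; mlin.
have UbUb_bil : @bilin C A A C^o (fun a b => Ubar a * Ubar b).
  by apply: bil => ?; mlin.
have cb := @conv2_bilin _ _ hA C^o *%R mb.
have cA := @conv2A _ _ hA C^o *%R mb (@mulrA C).
have cul := @conv2_unitl _ _ hA C^o *%R 1 mb (@mul1r C).
have unitE x y : eps x * eps y = @conv2_unit _ A C^o 1 x y.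
  by rewrite /conv2_unit /GRing.scale /= mulr1.
apply: (@conv2_inv_uniq _ _ hA C^o *%R 1 mb (@mulrA C) (@mul1r C) (@mulr1 C)
  _ (@conv2 _ A C^o *%R gf Um)).
- exact: cb.
- exact: cb.
- exact: cb.
- move=> x y; rewrite cA//; last exact: cb.
  transitivity (@conv2 _ A C^o *%R Ubm Um x y).
    apply: eq_conv2 => // {}x {}y; rewrite -cA//.
    transitivity (@conv2 _ A C^o *%R (@conv2_unit _ A C^o 1) Um x y); last exact: cul.
    by apply: eq_conv2 => // {}x {}y; rewrite -unitE -(cocycle_invl hg).
  rewrite -unitE -(counitM hA) -cocUbar_U (comulM hA) tsum_tsums; [|mlin|mlin].
  apply: eq_tsum => p q; rewrite tsum_tsums; [|mlin|mlin].
  by apply: eq_tsum => r s; rewrite tsum_tensEs//; mlin.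
- move=> x y; rewrite -cA//; last exact: cb.
  rewrite -unitE -cocU_conv; apply: eq_conv2 => // {}x {}y.
  by rewrite cA// [LHS]cocU_mul.
Qed.

(** [cocUbar_mul] composed with the inverse antipode, which reverses products and
    coproducts. *)
Lemma cocVbar_mul a b :
  \tsum_(a1, a2 <- D a) \tsum_(b1, b2 <- D b)
    (gbar (tens (antipode_inv a1) (antipode_inv b1)) * Vbar (b2 ⋅ a2)) =
  \tsum_(a1, a2 <- D a) \tsum_(b1, b2 <- D b)
    (Vbar a1 * Vbar b1 * g (tens b2 a2)).
Proof.
have hi := antipode_inv_lin hA; have hVb := cocVbar_slin.
rewrite -(antipode_invK hA a) -(antipode_invK hA b).
move: (antipode_inv a) (antipode_inv b) => {}a {}b.
have := cocUbar_mul a b; rewrite /conv2s /conv2 /Ubm /gbf /gS => e.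
transitivity (\tsum_(a1, a2 <- D a) \tsum_(b1, b2 <- D b)
    (Ubar (a1 ⋅ b1) * gbar (tens a2 b2))).
  etransitivity; first by comb.
  cbv beta; apply: eq_tsum => x y; apply: eq_tsum => p q.
  by rewrite -(antipodeM hA) /cocVbar !(antipodeK hA) mulrC.
rewrite [LHS]e; symmetry; etransitivity; first by comb.
cbv beta; apply: eq_tsum => x y; apply: eq_tsum => p q.
by rewrite /cocVbar !(antipodeK hA) mulrC.
Qed.

Section TwistedProducts.
Context {M N P Q Q' X : lmodType C}.
Context (dM : M -> tensor A M) (dN : N -> tensor A N) (dP : P -> tensor A P).
Context (dQ : Q -> tensor A Q) (dQ' : Q' -> tensor A Q').
Hypotheses (hM : is_comodule dM) (hN : is_comodule dN) (hP : is_comodule dP).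
Hypotheses (hQ : is_comodule dQ) (hQ' : is_comodule dQ').
Context (mu : M -> N -> Q) (nu : N -> P -> Q') (al : Q -> P -> X) (be : M -> Q' -> X).
Hypotheses (mu_bil : bilin mu) (nu_bil : bilin nu) (al_bil : bilin al) (be_bil : bilin be).
Hypothesis mu_colin : colinear2 dM dN dQ mu.
Hypothesis nu_colin : colinear2 dN dP dQ' nu.

(** All cocycle values are collected on legs in A, where the cocycle identity can be
    applied directly. *)
Lemma twist_prodl m n p : twist_prod g dQ dP al (twist_prod g dM dN mu m n) p =
  \tsum_(m1, m0 <- dM m) \tsum_(n1, n0 <- dN n) \tsum_(p1, p0 <- dP p)
    (\tsum_(x, x' <- D m1) \tsum_(y, y' <- D n1)
       (g (tens x y) * g (tens (x' ⋅ y') p1))) *: al (mu m0 n0) p0.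
Proof.
have tb : bilin (twist_prod g dQ dP al) by apply: twist_prod_bilin => //; mlin.
rewrite {2}/twist_prod (lin_tsum _ _ (tb.1 p)).
under eq_tsum => m1 m0.
  rewrite (lin_tsum _ _ (tb.1 p)); under eq_tsum => n1 n0.
    rewrite (linZ _ _ (tb.1 p)) /twist_prod mu_colin scale_tsum.
    under eq_tsum do rewrite scale_tsum.
  over.
over.
under [RHS]eq_tsum do under eq_tsum do under eq_tsum do rewrite tsum_scale.
under [RHS]eq_tsum do under eq_tsum do under eq_tsum do under eq_tsum do rewrite tsum_scale.
cbv beta; sweedler.
by rewrite scalerA.
Qed.

Lemma twist_prodr m n p : twist_prod g dM dQ' be m (twist_prod g dN dP nu n p) =
  \tsum_(m1, m0 <- dM m) \tsum_(n1, n0 <- dN n) \tsum_(p1, p0 <- dP p)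
    (\tsum_(y, y' <- D n1) \tsum_(z, z' <- D p1)
       (g (tens y z) * g (tens m1 (y' ⋅ z')))) *: be m0 (nu n0 p0).
Proof.
have tb : bilin (twist_prod g dM dQ' be) by apply: twist_prod_bilin => //; mlin.
rewrite {2}/twist_prod (lin_tsum _ _ (tb.2 m)).
under eq_tsum => n1 n0.
  rewrite (lin_tsum _ _ (tb.2 m)); under eq_tsum => p1 p0.
    rewrite (linZ _ _ (tb.2 m)) /twist_prod scale_tsum.
    under eq_tsum do rewrite nu_colin scale_tsum.
  over.
  rewrite tsumC.
over.
rewrite tsumC.
under [RHS]eq_tsum do under eq_tsum do under eq_tsum do rewrite tsum_scale.
under [RHS]eq_tsum do under eq_tsum do under eq_tsum do under eq_tsum do rewrite tsum_scale.
cbv beta; sweedler.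
by rewrite scalerA.
Qed.

Lemma twist_prodA : (forall m n p, al (mu m n) p = be m (nu n p)) -> forall m n p,
  twist_prod g dQ dP al (twist_prod g dM dN mu m n) p =
  twist_prod g dM dQ' be m (twist_prod g dN dP nu n p).
Proof.
move=> e m n p; rewrite twist_prodl twist_prodr.
by do 3!apply: eq_tsum => ? ?; rewrite (cocycleP hg) e.
Qed.

End TwistedProducts.

(** The one-sided deformation g(a_(1), b_(1)) a_(2) b_(2) of A is associative and
    unital; the deformed product of [twist_hopf] is [lprod] followed by gbar on the
    remaining legs, and the deformed antipode is U times [half_antipode]. *)
Notation lprod := (twist_prod g D D (hmul A)).
Let half_antipode (a : A) : A := \tsum_(x, y <- D a) Ubar y *: S x.
Notation Ag := (twist_hopf g gbar).

Let lprod_bil : bilin lprod.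
Proof. by apply: twist_prod_bilin; [mlin|mlin|exact: hmul_bilin]. Qed.
Let half_antipode_lin : lin half_antipode. Proof. by rewrite /half_antipode; mlin. Qed.

Lemma lprodA a b c : lprod (lprod a b) c = lprod a (lprod b c).
Proof.
have hD := comul_comodule hA; have hm := hmul_bilin hA.
by apply: twist_prodA => // [? ?|? ?|x y z]; rewrite ?(comulM hA)// (hmulA hA).
Qed.

Lemma lprod1 a : lprod one a = a.
Proof.
rewrite /twist_prod (comul1 hA) tsum_tensE; [|mlin|mlin].
under eq_tsum do rewrite (cocycle1l hg) (hmul1 hA).
exact: (counitl hA).
Qed.

Lemma cocUbar_cancel a :
  \tsum_(x, v <- D a) \tsum_(y, z <- D v) (g (tens (S x) z) * Ubar y) = eps a.
Proof.
transitivity (\tsum_(k, m <- D a) (eps (S k) * eps m)); last first.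
  under eq_tsum do rewrite (counit_antipode hA).
  by rewrite (coact_counitEs (f := eps))//; [comod|mlin].
transitivity (\tsum_(k, m <- D a) \tsum_(b1, b2 <- D (S k)) \tsum_(c1, c2 <- D m)
  (gbar (tens b1 c1) * g (tens b2 c2))).
  under eq_tsum do under eq_tsum do rewrite mul_tsum.
  by sweedler.
by apply: eq_tsum => k m; rewrite (cocycle_invl hg).
Qed.

(** The left antipode axiom, for [lprod]. *)
Lemma half_antipode_cancel a : \tsum_(x, y <- D a) lprod (half_antipode x) y = eps a *: one.
Proof.
transitivity (\tsum_(e1, t <- D a) \tsum_(w, e5 <- D t)
  ((\tsum_(x, v <- D w) \tsum_(y, z <- D v) (g (tens (S x) z) * Ubar y)) *: (S e1 ⋅ e5))).
  under eq_tsum => x y.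
    rewrite {1}/half_antipode (lin_tsum _ _ (lprod_bil.1 y)); under eq_tsum => p q.
      rewrite (linZ _ _ (lprod_bil.1 y)) /twist_prod scale_tsum.
      under eq_tsum do rewrite scale_tsum.
    over.
  over.
  under [RHS]eq_tsum do under eq_tsum do rewrite tsum_scale.
  under [RHS]eq_tsum do under eq_tsum do under eq_tsum do rewrite tsum_scale.
  cbv beta; sweedler.
  by rewrite scalerA mulrC.
under eq_tsum do under eq_tsum do rewrite cocUbar_cancel.
under eq_tsum => e1 t.
  rewrite (coact_counitE (f := fun e5 => S e1 ⋅ e5)); [|comod|mlin].
over.
exact: (antipodel hA).
Qed.

Lemma hmul_twist_bilin : bilin (hmul Ag).
Proof. by split=> ?; rewrite /=; mlin. Qed.

Lemma twisted_antipode_mul (a b : A) : hmul Ag (antipode Ag a) b = (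
  \tsum_(a1, x <- D a) \tsum_(a2, a3 <- D x) \tsum_(b1, b2 <- D b)
    (U a1 * gbar (tens (S a2) b2)) *: lprod (half_antipode a3) b1 : A).
Proof.
have hm := hmul_twist_bilin.
rewrite [antipode Ag a]/= (lin_tsum _ _ (hm.1 b)).
under eq_tsum => h1 h23.
  rewrite (lin_tsum _ _ (hm.1 b)); under eq_tsum => h2 h3.
    rewrite (linZ _ _ (hm.1 b)) /= scale_tsum; under eq_tsum => p q.
      rewrite scale_tsum; under eq_tsum => r s.
        rewrite scale_tsum; under eq_tsum => r' s'.
          rewrite scale_tsum; under eq_tsum do rewrite scalerA.
        over.
      over.
    over.
  over.
over.
under [RHS]eq_tsum => a1 x.
  under eq_tsum => a2 a3.
    under eq_tsum => b1 b2.
      rewrite {1}/half_antipode (lin_tsum _ _ (lprod_bil.1 b1)) scale_tsum; under eq_tsum => p q.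
        rewrite (linZ _ _ (lprod_bil.1 b1)) /twist_prod !scale_tsum.
        under eq_tsum do rewrite !scale_tsum.
      over.
    over.
  over.
over.
cbv beta; sweedler.
by rewrite !scalerA; congr (_ *: _); ring.
Qed.

(** With z = a_(3) b_(2) and g(a_(2), b_(1)) absorbed into a product [lprod], the
    factor [half_antipode] cancels a leg of a by associativity of [lprod]. There
    remains U(a_(1)) gbar(S(a_(2)), a_(3) b_(2)), which [cocycle_antipode_inv] turns
    into g(a_(1), S(a_(2)) a_(3) b_(2)). *)
Lemma twisted_antipode_cancel (a b : A) :
  \tsum_(x, t <- D a) \tsum_(y, z <- D t) \tsum_(p, q <- D b)
    (g (tens y p) *: (hmul Ag (antipode Ag (x : A)) (z ⋅ q : A) : A)) =
  \tsum_(p, q <- D b) (g (tens a q) *: p).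
Proof.
transitivity (\tsum_(a1, t <- D a) \tsum_(a2, u <- D t) \tsum_(v, z2 <- D u)
   \tsum_(r, q2 <- D b) (U a1 * gbar (tens (S a2) (z2 ⋅ q2))) *:
     (\tsum_(w, y <- D v) lprod (half_antipode w) (lprod y r))).
  under eq_tsum do under eq_tsum do under eq_tsum do
    rewrite twisted_antipode_mul scale_tsum.
  under eq_tsum do under eq_tsum do under eq_tsum do under eq_tsum do
    rewrite scale_tsum.
  under eq_tsum do under eq_tsum do under eq_tsum do under eq_tsum do under eq_tsum do
    rewrite scale_tsum.
  under [RHS]eq_tsum do under eq_tsum do under eq_tsum do under eq_tsum do
    rewrite scale_tsum.
  under [RHS]eq_tsum => a1 t.
    under eq_tsum => a2 u.
      under eq_tsum => v z2.
        under eq_tsum => r q2.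
          under eq_tsum => w y.
            rewrite {2}/twist_prod (lin_tsum _ _ (lprod_bil.2 (half_antipode w))) scale_tsum.
            under eq_tsum => y1 y2.
              rewrite (lin_tsum _ _ (lprod_bil.2 (half_antipode w))) scale_tsum.
              under eq_tsum do rewrite (linZ _ _ (lprod_bil.2 (half_antipode w))).
            over.
          over.
        over.
      over.
    over.
  over.
  cbv beta; sweedler.
  by rewrite !scalerA; congr (_ *: _); ring.
under eq_tsum => a1 t.
  under eq_tsum => a2 u.
    under eq_tsum => v z2.
      under eq_tsum => r q2.
        under eq_tsum do rewrite -lprodA.
        rewrite -(lin_tsum _ _ (lprod_bil.1 r)) half_antipode_cancel (linZ _ _ (lprod_bil.1 r)) lprod1.
        rewrite scalerA mulrC -scalerA.
      over.
      rewrite -scale_tsum.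
    over.
    rewrite (coact_counitE (f := fun z2 => \tsum_(r, q2 <- D b)
      (U a1 * gbar (tens (S a2) (z2 ⋅ q2))) *: r)); [|comod|mlin].
  over.
over.
transitivity (\tsum_(x, z <- D a) \tsum_(r, q <- D b)
  ((\tsum_(a1, a2 <- D x) (U a1 * gbar (tens (S a2) (z ⋅ q)))) *: r)).
  under [RHS]eq_tsum do under eq_tsum do rewrite tsum_scale.
  by cbv beta; sweedler.
under eq_tsum do under eq_tsum do rewrite -cocycle_antipode_inv tsum_scale.
transitivity (\tsum_(r, q <- D b) \tsum_(a1, t <- D a) \tsum_(a2, z <- D t)
  (g (tens a1 (S a2 ⋅ z ⋅ q)) *: r)).
  rewrite tsumC; apply: eq_tsum => r q.
  sweedler.
  by rewrite (hmulA hA).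
apply: eq_tsum => r q.
under eq_tsum => a1 t.
  rewrite (antipodelE hA (f := fun v => g (tens a1 (v ⋅ q)) *: r)); last by mlin.
  rewrite (hmul1 hA).
over.
by rewrite (counit_rightE hA (f := fun a1 => g (tens a1 q) *: r))//; mlin.
Qed.

End Cocycle.

(** * Deformed involutions *)

Section TwistedConjugation.
Context {C : numClosedFieldType} {A : hopfStarData C} (hA : is_hopf_star_algebra A).
Context (g gbar : {scalar tensor A A}) (hg : is_unitary_2cocycle g gbar).
Notation D := (comul A).
Notation "a ⋅ b" := (hmul A a b) (at level 40, left associativity).
Notation V := (cocV g).
Notation Vbar := (cocVbar gbar).
Let cocV_slin' : slin V := cocV_slin hA g.
Let cocVbar_slin' : slin Vbar := cocVbar_slin hA gbar.

Section Conjugation.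
Context {M M' : lmodType C} (dM : M -> tensor A M) (dM' : M' -> tensor A M').

Definition anticolinear (J : M -> M') := antilinear J /\ forall m, dM' (J m) =
  \tsum_(m1, m0 <- dM m) tens (hstar A m1) (J m0).

(** The involution of [twist_comod], the map [frakN] and the inverse of [frakN] are
    the cases where J is the involution of B, [bar] and [unbar]. *)
Definition conj_twist (J : M -> M') m : M' :=
  \tsum_(m1, m0 <- dM m) Vbar (hstar A m1) *: J m0.

Lemma tsum_anticolinear J (X : lmodType C) (F : A -> M' -> X) m : anticolinear J ->
  (forall n, lin (F^~ n)) -> (forall a, lin (F a)) ->
  \tsum_(a, n <- dM' (J m)) F a n = \tsum_(m1, m0 <- dM m) F (hstar A m1) (J m0).
Proof.
move=> [_ ->] h1 h2; rewrite tsum_tsum//.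
by apply: eq_tsum => a n; rewrite tsum_tensE.
Qed.

Lemma conj_twistE J m : anticolinear J ->
  conj_twist J m = \tsum_(a, n <- dM' (J m)) Vbar a *: n.
Proof.
by move=> hJ; rewrite (tsum_anticolinear _ hJ)//; mlin.
Qed.

Lemma conj_twist_antilinear J : anticolinear J -> lin dM' -> antilinear (conj_twist J).
Proof.
move=> hJ hd c u v; have h : lin (fun n => \tsum_(a, n <- dM' n) Vbar a *: n) by mlin.
by rewrite !(conj_twistE _ hJ) hJ.1 h.
Qed.

End Conjugation.

(** The conjugate of Vbar(m_(-1)^* ) is V(m_(-1)), so the composite acts by the
    convolution product of V and Vbar. *)
Lemma conj_twistK (M M' : lmodType C) (dM : M -> tensor A M) (dM' : M' -> tensor A M')
    (J : M -> M') (J' : M' -> M) : is_comodule dM ->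
  anticolinear dM dM' J -> anticolinear dM' dM J' -> cancel J J' ->
  cancel (conj_twist dM J) (conj_twist dM' J').
Proof.
move=> hM hJ hJ' JK m; rewrite (conj_twistE _ hJ').
have -> : J' (conj_twist dM J m) = \tsum_(m1, m0 <- dM m) V m1 *: m0.
  rewrite /conj_twist (anti_tsum _ _ hJ'.1); apply: eq_tsum => m1 m0.
  by rewrite (antiZ _ _ hJ'.1) (conj_Vbar hA hg) JK.
have hL : lin (fun n => \tsum_(a, n <- dM n) Vbar a *: n) by mlin.
rewrite [LHS](lin_tsum _ _ hL).
under eq_tsum do rewrite (linZ _ _ hL) scale_tsum.
transitivity (\tsum_(x, n <- dM m) ((\tsum_(a, b <- D x) (V a * Vbar b)) *: n)).
  under [RHS]eq_tsum do rewrite tsum_scale.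
  by cbv beta; sweedler; rewrite scalerA.
under eq_tsum do rewrite (cocV_Vbar hA hg).
exact: (coact_counit hM).
Qed.

Section ConjProd.
Context {M N Q M' N' Q' : lmodType C}.
Context (dM : M -> tensor A M) (dN : N -> tensor A N) (dQ : Q -> tensor A Q).
Context (dM' : M' -> tensor A M') (dN' : N' -> tensor A N') (dQ' : Q' -> tensor A Q').
Hypotheses (hM' : is_comodule dM') (hN' : is_comodule dN') (hQ' : is_comodule dQ').
Context (JM : M -> M') (JN : N -> N') (JQ : Q -> Q').
Hypotheses (hJM : anticolinear dM dM' JM) (hJN : anticolinear dN dN' JN).
Hypotheses (hJQ : anticolinear dQ dQ' JQ).
Context (mu : M -> N -> Q) (mu' : N' -> M' -> Q').
Hypotheses (mu'_bil : bilin mu').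
Hypothesis mu_conj : forall m n, JQ (mu m n) = mu' (JN n) (JM m).

Lemma conj_colinear m n : colinear2 dM dN dQ mu ->
  dQ' (mu' (JN n) (JM m)) =
  \tsum_(n1, n0 <- dN' (JN n)) \tsum_(m1, m0 <- dM' (JM m))
    tens (n1 ⋅ m1) (mu' n0 m0).
Proof.
move=> mu_colin; rewrite -mu_conj hJQ.2 mu_colin.
pose F (a : A) (q : Q) : conjv (tensor A Q') := tens (hstar A a) (JQ q).
have F1 q : lin (F^~ q).
  by move=> c x y; rewrite /F (hstar_antilinear hA) ((tens_bilin _ _).1 _ _ _ _).
have F2 a : lin (F a).
  by move=> c x y; rewrite /F hJQ.1 ((tens_bilin _ _).2 _ _ _ _).
transitivity (tsum F (\tsum_(m1, m0 <- dM m) \tsum_(n1, n0 <- dN n)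
  tens (m1 ⋅ n1) (mu m0 n0))) => //.
rewrite tsum_tsum//.
under eq_tsum => m1 m0.
  rewrite tsum_tsum//.
  under eq_tsum do rewrite tsum_tensE// /F (hstarM hA) mu_conj.
over.
rewrite (tsum_anticolinear _ hJN); [|mlin|mlin].
under [RHS]eq_tsum do (rewrite (tsum_anticolinear _ hJM); [|mlin|mlin]).
by rewrite [RHS]tsumC.
Qed.

(** Unitarity turns the conjugate of g(m_(-1), n_(-1)) into gbar at the inverse
    antipodes of the conjugated legs; the two sides then differ by [cocVbar_mul]. *)
Lemma conj_twist_prod m n : colinear2 dN' dM' dQ' mu' ->
  conj_twist dQ JQ (twist_prod g dM dN mu m n) =
  twist_prod g dN' dM' mu' (conj_twist dN JN n) (conj_twist dM JM m).
Proof.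
have hi := antipode_inv_lin hA.
move=> mu_colin; rewrite (conj_twistE _ hJQ) (conj_twistE _ hJN) (conj_twistE _ hJM).
have -> : JQ (twist_prod g dM dN mu m n) =
    \tsum_(m1, m0 <- dM' (JM m)) \tsum_(n1, n0 <- dN' (JN n))
      gbar (tens (antipode_inv m1) (antipode_inv n1)) *: mu' n0 m0.
  rewrite (tsum_anticolinear _ hJM); [|mlin|mlin].
  under [RHS]eq_tsum do (rewrite (tsum_anticolinear _ hJN); [|mlin|mlin]).
  rewrite /twist_prod (anti_tsum _ _ hJQ.1); apply: eq_tsum => m1 m0.
  rewrite (anti_tsum _ _ hJQ.1); apply: eq_tsum => n1 n0.
  by rewrite (antiZ _ _ hJQ.1) mu_conj (conj_g hA hg).
move: (JM m) (JN n) => {}m {}n.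
pose L q := \tsum_(a, q0 <- dQ' q) Vbar a *: q0.
have hL : lin L by rewrite /L; mlin.
transitivity (\tsum_(x, m0 <- dM' m) \tsum_(y, n0 <- dN' n)
  ((\tsum_(m1, m2 <- D x) \tsum_(n1, n2 <- D y)
    (gbar (tens (antipode_inv m1) (antipode_inv n1)) * Vbar (n2 ⋅ m2))) *: mu' n0 m0)).
  rewrite -/(L _) (lin_tsum _ _ hL).
  under eq_tsum => m1 m0.
    rewrite (lin_tsum _ _ hL); under eq_tsum => n1 n0.
      rewrite (linZ _ _ hL) /L mu_colin.
      rewrite tsum_tsum; [|mlin|mlin].
      under eq_tsum => p q.
        rewrite tsum_tsum; [|mlin|mlin].
        under eq_tsum => r s.
          rewrite tsum_tensE; [|mlin|mlin].
        over.
      over.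
      rewrite tsumC scale_tsum; under eq_tsum do rewrite scale_tsum.
    over.
  over.
  under [RHS]eq_tsum do under eq_tsum do rewrite tsum_scale.
  under [RHS]eq_tsum do under eq_tsum do under eq_tsum do rewrite tsum_scale.
  by cbv beta; sweedler; rewrite scalerA.
under eq_tsum do under eq_tsum do rewrite (cocVbar_mul hA hg).
have tb : bilin (twist_prod g dN' dM' mu') by apply: twist_prod_bilin => //; mlin.
rewrite (lin_tsum _ _ (tb.1 _)).
under [RHS]eq_tsum => n1 n0.
  rewrite (linZ _ _ (tb.1 _)) (lin_tsum _ _ (tb.2 _)) scale_tsum.
  under eq_tsum => m1 m0.
    rewrite (linZ _ _ (tb.2 _)) /twist_prod !scale_tsum.
    under eq_tsum do rewrite !scale_tsum.
  over.
over.
rewrite tsumC.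
under eq_tsum do under eq_tsum do rewrite tsum_scale.
under eq_tsum do under eq_tsum do under eq_tsum do rewrite tsum_scale.
cbv beta; sweedler.
by rewrite !scalerA; congr (_ *: _); ring.
Qed.

End ConjProd.

End TwistedConjugation.
(** * Covariant bimodules and their conjugates *)

Section CovariantBimodule.
Context {C : numClosedFieldType} {A : hopfStarData C} (hA : is_hopf_star_algebra A).
Context {B : comodStarData A} (hB : is_comodule_star_algebra B).
Context {E : bimodData B} (hE : is_covariant_bimodule E).
Notation D := (comul A).
Notation dB := (bcoact B).
Notation dE := (coact E).
Notation Ebar := (conj_bimod E).
Notation dEbar := (coact (conj_bimod E)).

Lemma lact_bilin : bilin (lact E).
Proof. by have [h1 h2] := lact_bilinear (lact_module hE). Qed.

Lemma ract_bilin : bilin (ract E).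
Proof. by have [h1 h2] := ract_bilinear hE. Qed.

Lemma bcoactM_colinear : colinear2 dB dB dB (bmul B).
Proof. exact: bcoactM. Qed.

Let dB_comod : is_comodule dB := bcoact_comodule hB.
Let dE_comod : is_comodule dE := coact_comodule hE.

Lemma coact_lact : colinear2 dB dE dE (lact E).
Proof.
have hl := lact_bilin; have hr := ract_bilin.
move=> b m; rewrite -(ract1 hE (lact E b m)) (coactM hE).
apply: eq_tsum => b1 b0; apply: eq_tsum => m1 m0.
rewrite (bcoact1 hB) tsum_tensE; [|mlin|mlin].
by rewrite (hmulr1 hA) (ract1 hE).
Qed.

Lemma coact_ract : colinear2 dE dB dE (ract E).
Proof.
have hl := lact_bilin; have hr := ract_bilin.
move=> m b; rewrite -{1}(lact1 (lact_module hE) m) (coactM hE).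
rewrite (bcoact1 hB) tsum_tensE; [|mlin|mlin].
by under eq_tsum do under eq_tsum do rewrite (hmul1 hA) (lact1 (lact_module hE)).
Qed.

Lemma bstar_anticolinear : anticolinear dB dB (bstar B).
Proof. by split; [exact: bstar_antilinear | exact: bcoact_star]. Qed.

Lemma bar_anticolinear : anticolinear dE dEbar (@bar C E).
Proof. by split=> // c u v; rewrite /GRing.scale /= /conj_scale conjCK. Qed.

Lemma tsum_conj_coact (X : lmodType C) (F : A -> Ebar -> X) (n : Ebar) :
  (forall n, lin (F^~ n)) -> (forall a, lin (F a)) ->
  \tsum_(a, m <- dEbar n) F a m =
  \tsum_(e1, e0 <- dE (unbar n)) F (hstar A e1) (bar e0).
Proof. by move=> h1 h2; apply: (tsum_anticolinear (unbar n) bar_anticolinear). Qed.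

Lemma unbar_anticolinear : anticolinear dEbar dE (@unbar C E).
Proof.
split=> // n; symmetry.
pose F (a : A) (m : Ebar) : conjv (tensor A E) := tens (hstar A a) (unbar m).
have F1 q : lin (F^~ q).
  by move=> c x y; rewrite /F (hstar_antilinear hA) ((tens_bilin _ _).1 _ _ _ _).
have F2 a : lin (F a) by move=> c x y; rewrite /F ((tens_bilin _ _).2 _ _ _ _).
rewrite [LHS](tsum_conj_coact (F := F))//.
transitivity (\tsum_(e1, e0 <- dE (unbar n)) tens e1 e0); last exact: tsum_tens_id.
by apply: eq_tsum => e1 e0; rewrite /F (hstarK hA).
Qed.

Lemma conj_comodule : is_comodule dEbar.
Proof.
have dl : lin dEbar.
  move=> c u v; pose F (a : A) (m : E) : conjv (tensor A Ebar) := tens (hstar A a) (bar m).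
  have F1 q : lin (F^~ q).
    by move=> d x y; rewrite /F (hstar_antilinear hA) ((tens_bilin _ _).1 _ _ _ _).
  have F2 a : lin (F a).
    by move=> d x y; rewrite /F bar_anticolinear.1 ((tens_bilin _ _).2 _ _ _ _).
  have h : lin (tsum F) by exact: (@lin_tsumt _ _ _ _ _ F id).
  rewrite -[dEbar _]/(tsum F (dE (c^* *: unbar u + unbar v))).
  rewrite (coact_linear dE_comod) h /GRing.scale /= /conj_scale conjCK.
  by [].
split=> // n.
- rewrite tsum_conj_coact; [|mlin|mlin].
  rewrite [RHS]tsum_conj_coact; [|mlin|mlin].
  under eq_tsum do (rewrite (tsum_comul_star hA); [|mlin|mlin]).
  pose F (a b : A) (m : E) : conjv (tensor A (tensor A Ebar)) :=
    tens (hstar A a) (tens (hstar A b) (bar m)).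
  transitivity (\tsum_(e1, m <- dE (unbar n)) \tsum_(e2, e0 <- dE m) F e1 e2 e0).
    apply: (coassoc (F := F)) => //.
    + move=> b m c x y; rewrite /F (hstar_antilinear hA).
      by rewrite ((tens_bilin _ _).1 _ _ _ _).
    + move=> a m c x y; rewrite /F (hstar_antilinear hA).
      by rewrite ((tens_bilin _ _).1 _ _ _ _) ((tens_bilin _ _).2 _ _ _ _).
    + move=> a b c x y; rewrite /F bar_anticolinear.1.
      by rewrite !((tens_bilin _ _).2 _ _ _ _).
  apply: eq_tsum => e1 m; rewrite /= /F.
  by rewrite [RHS](lin_tsum _ _ ((tens_bilin _ _).2 _)).
- rewrite tsum_conj_coact; [|mlin|mlin].
  rewrite -[in RHS](coact_counit dE_comod (unbar n) : _ = n).
  rewrite [RHS](anti_tsum _ _ bar_anticolinear.1).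
  apply: eq_tsum => e1 e0.
  by rewrite (counit_star hA) (antiZ _ _ bar_anticolinear.1).
Qed.

Lemma conj_lact_bilin : bilin (lact Ebar).
Proof.
have hr := ract_bilin.
split=> n c x y; rewrite /= /GRing.scale /= /conj_scale /bar /unbar.
  by rewrite (bstar_antilinear hB) (hr.2 _ _ _ _).
by rewrite (hr.1 _ _ _ _).
Qed.

Lemma conj_ract_bilin : bilin (ract Ebar).
Proof.
have hr := lact_bilin.
split=> n c x y; rewrite /= /GRing.scale /= /conj_scale /bar /unbar.
  by rewrite (hr.2 _ _ _ _).
by rewrite (bstar_antilinear hB) (hr.1 _ _ _ _).
Qed.

Lemma conj_coact_lact : colinear2 dB dEbar dEbar (lact Ebar).
Proof.
move=> b n; rewrite -(bstarK hB b) -[n]/(bar (unbar n)).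
apply: (conj_colinear hA bar_anticolinear bstar_anticolinear bar_anticolinear
  conj_lact_bilin _ _ _ coact_ract) => m c.
by rewrite /= bstarK.
Qed.

Lemma conj_coact_ract : colinear2 dEbar dB dEbar (ract Ebar).
Proof.
move=> n b; rewrite -(bstarK hB b) -[n]/(bar (unbar n)).
apply: (conj_colinear hA bstar_anticolinear bar_anticolinear bar_anticolinear
  conj_ract_bilin _ _ _ coact_lact) => m c.
by rewrite /= bstarK.
Qed.

End CovariantBimodule.
(** * The pairing defined by a metric *)

Section HomB.
Context {C : numClosedFieldType} {A : hopfStarData C} {B : comodStarData A}.
Context {E : bimodData B}.

Lemma homB_lin (f : homB E) : lin f.
Proof. by have /asboolP[] := homB_prop f. Qed.

Lemma homB_lact (f : homB E) b e : f (lact E b e) = bmul B b (f e).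
Proof. by have /asboolP[_] := homB_prop f. Qed.

Lemma homB_eval_lin e : lin (fun f : homB E => f e).
Proof. by move=> c f h. Qed.

Lemma homB_eq (f h : homB E) : (forall e, f e = h e) -> f = h.
Proof. by move=> e; apply: val_inj; apply: funext. Qed.

Lemma to_homB_eq (f : E -> B) (h : homB E) : (forall e, h e = f e) -> to_homB f = h.
Proof.
move=> e; have -> : f = h by apply: funext => x; rewrite e.
by apply: homB_eq => x; rewrite to_homBE//; have /asboolP := homB_prop h.
Qed.

End HomB.

Section DualBasis.
Context {C : numClosedFieldType} {A : hopfStarData C}.
Context {B : comodStarData A} (hB : is_comodule_star_algebra B).
Context {E : lmodType C} (act : B -> E -> E) (hact : is_left_module act).

(** The coordinates of a section of the projection of a free module onto E. *)
Lemma dual_basis : finitely_generated act -> projective act ->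
  exists (n : nat) (x : 'I_n -> E) (phi : 'I_n -> E -> B),
    (forall i, left_module_map act (bmul B) (phi i)) /\
    forall e, e = \sum_(i < n) act (phi i e) (x i).
Proof.
move=> [n [x gen_x]] proj.
pose P : lmodType C := {ffun 'I_n -> B}.
pose actP (b : B) (v : P) : P := [ffun i => bmul B b (v i)].
have hP : is_left_module actP.
  split.
  - by split=> [w|v] c y z; apply/ffunP => i; rewrite !ffunE ?linearPl ?linearPr.
  - by move=> a b m; apply/ffunP => i; rewrite !ffunE (bmulA hB).
  - by move=> m; apply/ffunP => i; rewrite !ffunE (bmul1 hB).
have [actl actr] := lact_bilinear hact.
pose pi (v : P) : E := \sum_(i < n) act (v i) (x i).
have pi_map : left_module_map actP act pi.
  split=> [c u v|b v].
    rewrite /pi scaler_sumr -big_split; apply: eq_bigr => i _.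
    by rewrite !ffunE actl.
  rewrite /pi (lin_sum _ _ (actr b)); apply: eq_bigr => i _.
  by rewrite ffunE (lactA hact).
have pi_surj q : exists v, pi v = q.
  have [b ->] := gen_x q; exists [ffun i => b i].
  by apply: eq_bigr => i _; rewrite ffunE.
have id_map : left_module_map act act id by [].
have [h [h_lin h_act] hK] := proj _ _ _ _ hP hact pi id pi_map pi_surj id_map.
exists n, x, (fun i e => h e i); split=> [i|e]; last by rewrite -[LHS]hK.
by split=> [c u v|b e]; rewrite ?h_lin ?h_act !ffunE.
Qed.

End DualBasis.

Section Metric.
Context {C : numClosedFieldType} {A : hopfStarData C} (hA : is_hopf_star_algebra A).
Context {B : comodStarData A} (hB : is_comodule_star_algebra B).
Context {E : bimodData B} (hE : is_covariant_bimodule E).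
Context (H : conj_bimod E -> hom_bimod E) (hH : is_hermitian_metric H).
Notation S := (antipode A).
Notation D := (comul A).
Notation dB := (bcoact B).
Notation dE := (coact E).
Notation Ebar := (conj_bimod E).
Notation dEbar := (coact (conj_bimod E)).
Notation "a ⋅ b" := (hmul A a b) (at level 40, left associativity).

Let dB_comod : is_comodule dB := bcoact_comodule hB.
Let dE_comod : is_comodule dE := coact_comodule hE.
Let dEbar_comod : is_comodule dEbar := conj_comodule hA hE.
Let le_bil : bilin (lact E) := lact_bilin hE.
Let re_bil : bilin (ract E) := ract_bilin hE.

Definition pairing (e : E) (n : Ebar) : B := (H n : homB E) e.
Let hmorph : is_morphism H := (metric_iso hH).1.

Lemma pairing_bilin : bilin pairing.
Proof.
split=> [n|e]; first exact: homB_lin.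
by move=> c m n; rewrite /pairing (morph_linear hmorph).
Qed.

Lemma pairing_lact b e n : pairing (lact E b e) n = bmul B b (pairing e n).
Proof. exact: homB_lact. Qed.

Lemma pairing_ract e n b : pairing e (ract Ebar n b) = bmul B (pairing e n) b.
Proof. by rewrite /pairing (morph_ract hmorph) hom_ractE. Qed.

Lemma pairing_balanced e b n : pairing (ract E e b) n = pairing e (lact Ebar b n).
Proof. by rewrite /pairing (morph_lact hmorph) hom_lactE. Qed.

Lemma pairing_star e n : bstar B (pairing e n) = pairing (unbar n) (bar e).
Proof. exact: (metric_herm hH). Qed.

Lemma pairing_dual_basis : exists (k : nat) (x : 'I_k -> E) (y : 'I_k -> Ebar),
  forall e, e = \sum_(i < k) lact E (pairing e (y i)) (x i).
Proof.
have [k [x [phi [hphi hx]]]] := dual_basis hB (lact_module hE) (metric_fg hH) (metric_proj hH).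
have [_ [G [_ _ GK]]] := metric_iso hH.
exists k, x, (fun i => G (to_homB (phi i))) => e.
rewrite [LHS]hx; apply: eq_bigr => i _.
by rewrite /pairing GK to_homBE.
Qed.

(** The value at e that the coaction of f is required to have. *)
Definition hom_coact_value (f : homB E) (e : E) : tensor A B :=
  \tsum_(e1, e0 <- dE e) \tsum_(w1, w0 <- dB (f e0)) tens (S e1 ⋅ w1) w0.

Lemma hom_coact_value_lin f : lin (hom_coact_value f).
Proof. by have hf := homB_lin f; rewrite /hom_coact_value; mlin. Qed.

Lemma hom_coact_value_lact f b e : hom_coact_value f (lact E b e) =
  \tsum_(w1, w0 <- hom_coact_value f e) tens w1 (bmul B b w0).
Proof.
have hf := homB_lin f.
rewrite /hom_coact_value (coact_lact hA hB hE).
transitivity (\tsum_(e1, e0 <- dE e) \tsum_(w1, w0 <- dB (f e0))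
  \tsum_(x, b0 <- dB b) \tsum_(p, q <- D x) tens (S e1 ⋅ (S p ⋅ q ⋅ w1)) (bmul B b0 w0)).
  rewrite tsum_tsum; [|mlin|mlin].
  under eq_tsum => b1 b0.
    rewrite tsum_tsum; [|mlin|mlin].
    under eq_tsum => e1 e0.
      rewrite tsum_tensE; [|mlin|mlin].
      rewrite homB_lact (bcoactM hB).
      rewrite tsum_tsum; [|mlin|mlin].
      under eq_tsum => b1' b0'.
        rewrite tsum_tsum; [|mlin|mlin].
        under eq_tsum do (rewrite tsum_tensE; [|mlin|mlin]).
      over.
    over.
  over.
  cbv beta.
  under [RHS]eq_tsum do rewrite tsumC.
  rewrite [RHS]tsumC.
  sweedler.
  by rewrite (antipodeM hA) !(hmulA hA).
rewrite tsum_tsum; [|mlin|mlin].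
apply: eq_tsum => e1 e0; rewrite tsum_tsum; [|mlin|mlin].
apply: eq_tsum => w1 w0; rewrite tsum_tensE; [|mlin|mlin].
under eq_tsum => x b0.
  rewrite (antipodelE hA (f := fun v => tens (S e1 ⋅ (v ⋅ w1)) (bmul B b0 w0))); last by mlin.
  rewrite (hmul1 hA).
over.
by rewrite (coact_counitE (f := fun b0 => tens (S e1 ⋅ w1) (bmul B b0 w0)))//; mlin.
Qed.

(** The element sum_i R(x_i)_(-1) (x) p(-, y_i) R(x_i)_(0), where R is
    [hom_coact_value f], has the required values at the x_i, and the values at other
    points are determined by B-linearity, which R shares by [hom_coact_value_lact]. *)
Lemma hom_coactE (f : homB E) e :
  \tsum_(a, h <- hom_coact f) tens a ((h : homB E) e) = hom_coact_value f e.
Proof.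
move: e; rewrite /hom_coact.
apply: (@xgetPex _ _ [set t : tensor A (homB E) | forall e : E,
  \tsum_(a, h <- t) tens a ((h : homB E) e) = hom_coact_value f e]%classic).
have [k [x [y xy]]] := pairing_dual_basis.
have hev := @homB_eval_lin _ _ _ E.
have hH_lin : lin (H : Ebar -> homB E) by exact: (morph_linear hmorph).
have hr := conj_ract_bilin hB hE.
have hv := hom_coact_value_lin f.
exists (\sum_(i < k) \tsum_(w1, w0 <- hom_coact_value f (x i))
  tens w1 (H (ract Ebar (y i) w0) : homB E)) => e /=.
pose ev (t : tensor A (homB E)) := \tsum_(a, h <- t) tens a ((h : homB E) e).
have ev_lin : lin ev.
  have he := hev e; rewrite /ev; mlin.
rewrite -/(ev _) (lin_sum _ _ ev_lin) [in RHS](xy e) (lin_sum _ _ hv).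
apply: eq_bigr => i _; rewrite hom_coact_value_lact (lin_tsum _ _ ev_lin).
have he := hev e.
apply: eq_tsum => w1 w0; rewrite /ev tsum_tensE; [|mlin|mlin].
by rewrite -[homB_fun _ e]/(pairing e _) pairing_ract.
Qed.

(** Colinearity of H determines n_(-1) (x) p(e, n_(0)) as
    S(e_(-1)) p(e_(0), n)_(-1) (x) p(e_(0), n)_(0); multiply by e_(-2). *)
Lemma pairing_colinear : colinear2 dE dEbar dB pairing.
Proof.
have pb := pairing_bilin.
have key e n : \tsum_(n1, n0 <- dEbar n) tens n1 (pairing e n0) = hom_coact_value (H n) e.
  have he := @homB_eval_lin _ _ _ E e.
  rewrite -hom_coactE -[hom_coact _]/(coact (hom_bimod E) (H n)) (morph_coact hmorph).
  rewrite [RHS]tsum_tsum; [|mlin|mlin]; apply: eq_tsum => n1 n0.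
  by rewrite tsum_tensE//; mlin.
move=> e n.
transitivity (\tsum_(e1, e0 <- dE e) \tsum_(r1, r0 <- hom_coact_value (H n) e0)
   tens (e1 ⋅ r1) r0); last first.
  apply: eq_tsum => e1 e0; rewrite -key [LHS]tsum_tsum; [|mlin|mlin].
  by apply: eq_tsum => n1 n0; rewrite tsum_tensE//; mlin.
have hf := homB_lin (H n).
transitivity (\tsum_(x, e0 <- dE e) \tsum_(p, q <- D x) \tsum_(w1, w0 <- dB (pairing e0 n))
  tens (p ⋅ S q ⋅ w1) w0).
  under [RHS]eq_tsum => x e0.
    rewrite (antipoderE hA (f := fun v => \tsum_(w1, w0 <- dB (pairing e0 n))
      tens (v ⋅ w1) w0)); last by mlin.
    under eq_tsum do rewrite (hmul1 hA).
    rewrite tsum_tens_id.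
  over.
  by rewrite (coact_counitE (f := fun e0 => dB (pairing e0 n)))//; mlin.
rewrite /hom_coact_value /pairing.
sweedler.
by rewrite (hmulA hA).
Qed.

End Metric.
Lemma morphism_inv (C : numClosedFieldType) (A : hopfStarData C) (B : comodStarData A)
    (M N : bimodData B) (f : M -> N) (h : N -> M) :
  is_morphism f -> cancel f h -> cancel h f -> is_morphism h.
Proof.
move=> hf fK hK; have f_inj := can_inj fK.
have f_lin : lin f := morph_linear hf.
have h_lin : lin h by move=> c u v; apply: f_inj; rewrite f_lin !hK.
split=> // [b m|m b|m].
- by apply: f_inj; rewrite (morph_lact hf) !hK.
- by apply: f_inj; rewrite (morph_ract hf) !hK.
rewrite -{2}(hK m) (morph_coact hf) tsum_tsum; [|mlin|mlin].
rewrite -[LHS]tsum_tens_id; apply: eq_tsum => a n.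
by rewrite tsum_tensE ?fK//; mlin.
Qed.

(** * The deformed metric *)

Section TwistedMetric.
Context {C : numClosedFieldType} {A : hopfStarData C} (hA : is_hopf_star_algebra A).
Context {B : comodStarData A} (hB : is_comodule_star_algebra B).
Context {E : bimodData B} (hE : is_covariant_bimodule E).
Context (H : conj_bimod E -> hom_bimod E) (hH : is_hermitian_metric H).
Context (g gbar : {scalar tensor A A}) (hg : is_unitary_2cocycle g gbar).
Notation S := (antipode A).
Notation D := (comul A).
Notation eps := (counit A).
Notation one := (hone A).
Notation dB := (bcoact B).
Notation dE := (coact E).
Notation Ebar := (conj_bimod E).
Notation dEbar := (coact (conj_bimod E)).
Notation "a ⋅ b" := (hmul A a b) (at level 40, left associativity).
Notation Ag := (twist_hopf g gbar).
Notation Bg := (twist_comod g gbar B).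
Notation Eg := (Gamma g gbar E).
Notation Egbar := (conj_bimod Eg).
Notation Hg := (twist_metric g gbar H).
Notation tw := (twist_prod g).
Notation p := (pairing H).
Notation N := (conj_twist gbar dE (@bar C E)).
Notation N' := (conj_twist gbar dEbar (@unbar C E)).
Notation star_g := (conj_twist gbar dB (bstar B)).

Let dB_comod : is_comodule dB := bcoact_comodule hB.
Let dE_comod : is_comodule dE := coact_comodule hE.
Let dEbar_comod : is_comodule dEbar := conj_comodule hA hE.
Let le_bil : bilin (lact E) := lact_bilin hE.
Let re_bil : bilin (ract E) := ract_bilin hE.
Let lbar_bil : bilin (lact Ebar) := conj_lact_bilin hB hE.
Let rbar_bil : bilin (ract Ebar) := conj_ract_bilin hB hE.
Let p_bil : bilin p := pairing_bilin hH.
Let bmul_bil : bilin (bmul B) := bilin_bundled (bmul B).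
Let p_colin : colinear2 dE dEbar dB p := pairing_colinear hA hB hE hH.
Let bar_anti := @bar_anticolinear _ _ _ E.
Let unbar_anti := @unbar_anticolinear _ _ hA _ E.
Let bstar_anti := bstar_anticolinear hB.
Let lact_colin := coact_lact hA hB hE.
Let ract_colin := coact_ract hA hB hE.
Let lbar_colin := conj_coact_lact hA hB hE.
Let rbar_colin := conj_coact_ract hA hB hE.
Let bmul_colin := bcoactM_colinear hB.

Notation pg := (tw dE dEbar p).

Lemma twisted_pairing_bilin : bilin pg.
Proof. by apply: twist_prod_bilin => //; mlin. Qed.

Lemma twisted_pairing_lact b e n :
  pg (tw dB dE (lact E) b e) n = tw dB dB (bmul B) b (pg e n).
Proof.
apply: (twist_prodA hA hg dB_comod dE_comod dEbar_comod dE_comod dB_comod) => //.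
by move=> *; exact: pairing_lact.
Qed.

Lemma twisted_pairing_ract e n b :
  pg e (tw dEbar dB (ract Ebar) n b) = tw dB dB (bmul B) (pg e n) b.
Proof.
symmetry.
apply: (twist_prodA hA hg dE_comod dEbar_comod dB_comod dB_comod dEbar_comod) => //.
by move=> *; rewrite pairing_ract.
Qed.

Lemma twisted_pairing_balanced e b n :
  pg (tw dE dB (ract E) e b) n = pg e (tw dB dEbar (lact Ebar) b n).
Proof.
apply: (twist_prodA hA hg dE_comod dB_comod dEbar_comod dE_comod dEbar_comod) => //.
by move=> *; rewrite pairing_balanced.
Qed.

Lemma star_gK b : star_g (star_g b) = b.
Proof. exact: (conj_twistK hA hg dB_comod bstar_anti bstar_anti (bstarK hB)). Qed.

Lemma N_K e : N' (N e) = e.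
Proof. exact: (conj_twistK hA hg dE_comod bar_anti unbar_anti). Qed.

Lemma N'_K n : N (N' n) = n.
Proof. exact: (conj_twistK hA hg dEbar_comod unbar_anti bar_anti). Qed.

Lemma N_lact b e : N (tw dB dE (lact E) b e) = tw dEbar dB (ract Ebar) (N e) (star_g b).
Proof.
apply: (conj_twist_prod hA hg dB_comod dEbar_comod dEbar_comod bstar_anti bar_anti
  bar_anti rbar_bil _ _ _ rbar_colin) => c m /=.
by rewrite (bstarK hB).
Qed.

Lemma N_ract e b : N (tw dE dB (ract E) e b) = tw dB dEbar (lact Ebar) (star_g b) (N e).
Proof.
apply: (conj_twist_prod hA hg dEbar_comod dB_comod dEbar_comod bar_anti bstar_anti
  bar_anti lbar_bil _ _ _ lbar_colin) => m c /=.
by rewrite (bstarK hB).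
Qed.

(** The pairing is its own reversal under [bar], [unbar] and the involution of B. *)
Lemma twisted_pairing_star e n : star_g (pg e n) = pg (N' n) (N e).
Proof.
apply: (conj_twist_prod hA hg dEbar_comod dE_comod dB_comod bar_anti unbar_anti
  bstar_anti p_bil _ _ _ p_colin) => m k.
exact: pairing_star.
Qed.

(** By colinearity of p the factor S(v_(-1)) in the definition of [frakS] cancels a
    leg of v and leaves n_(-1). *)
Lemma frakS_pairing n v :
  \tsum_(v1, v0 <- dE v) \tsum_(a, b <- D v1) \tsum_(w1, w0 <- dB (p v0 n))
      g (tens a (S b ⋅ w1)) *: w0 = pg v n.
Proof.
have pc := p_colin.
transitivity (\tsum_(v1, m <- dE v) \tsum_(x, v0 <- dE m) \tsum_(v2, v3 <- D x)
  \tsum_(n1, n0 <- dEbar n) g (tens v1 (S v2 ⋅ v3 ⋅ n1)) *: p v0 n0).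
  under eq_tsum => v1 v0.
    under eq_tsum => a b.
      rewrite pc tsum_tsum; [|mlin|mlin].
      under eq_tsum => x x0.
        rewrite tsum_tsum; [|mlin|mlin].
        under eq_tsum do (rewrite tsum_tensE; [|mlin|mlin]).
      over.
    over.
  over.
  cbv beta; sweedler.
  by rewrite (hmulA hA).
apply: eq_tsum => v1 m.
under eq_tsum => x v0.
  rewrite (antipodelE hA (f := fun u => \tsum_(n1, n0 <- dEbar n)
    g (tens v1 (u ⋅ n1)) *: p v0 n0)); last by mlin.
  under eq_tsum do rewrite (hmul1 hA).
over.
by rewrite (coact_counitE (f := fun v0 => \tsum_(n1, n0 <- dEbar n)
    g (tens v1 n1) *: p v0 n0))//; mlin.
Qed.

Lemma twist_metricE (n : Egbar) (e : E) : (Hg n : homB Eg) e = pg e (N (unbar n)).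
Proof.
rewrite /twist_metric /= /frakS to_homBE; first exact: frakS_pairing.
have -> : (fun v : E => \tsum_(v1, v0 <- dE v) \tsum_(a, b <- D v1)
    \tsum_(w1, w0 <- dB ((Gamma_map g gbar H (frakN g gbar n) : homB E) v0))
      g (tens a (S b ⋅ w1)) *: w0) = (fun v => pg v (N (unbar n))).
  by apply: funext => v; exact: frakS_pairing.
split; first exact: (twisted_pairing_bilin.1 (N (unbar n))).
by move=> b m; exact: twisted_pairing_lact.
Qed.

Lemma N_antilin : antilinear N.
Proof. exact: (conj_twist_antilinear hA gbar bar_anti (coact_linear dEbar_comod)). Qed.

Lemma twist_metric_lin : lin (Hg : Egbar -> homB Eg).
Proof.
move=> c u v; apply: homB_eq => e.
rewrite twist_metricE homB_eval_lin !twist_metricE -(twisted_pairing_bilin.2 e).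
by congr (pg e _); rewrite -[unbar _]/(c^* *: unbar u + unbar v) N_antilin conjCK.
Qed.

Lemma twist_metric_herm (x y : E) :
  bstar Bg ((Hg (bar x : Egbar) : homB Eg) y) = (Hg (bar y : Egbar) : homB Eg) x.
Proof.
rewrite !twist_metricE -[LHS]/(star_g (pg y (N x))).
by rewrite twisted_pairing_star N_K.
Qed.

Lemma twist_metric_lact b n : Hg (lact Egbar b n) = lact (hom_bimod Eg) b (Hg n).
Proof.
symmetry; apply: to_homB_eq => e; rewrite twist_metricE.
rewrite -[unbar _]/(tw dE dB (ract E) (unbar n) (star_g b)) N_ract star_gK.
by rewrite -twisted_pairing_balanced -twist_metricE.
Qed.

Lemma twist_metric_ractE n b e : (Hg (ract Egbar n b) : homB Eg) e =
  bmul Bg ((Hg n : homB Eg) e) b.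
Proof.
rewrite twist_metricE.
rewrite -[unbar _]/(tw dB dE (lact E) (star_g b) (unbar n)) N_lact star_gK.
by rewrite twisted_pairing_ract -twist_metricE.
Qed.

Lemma twist_metric_ract n b : Hg (ract Egbar n b) = ract (hom_bimod Eg) (Hg n) b.
Proof. by symmetry; apply: to_homB_eq => e; exact: twist_metric_ractE. Qed.

Section Coinvariance.
Context (k : nat) (x : 'I_k -> E) (y : 'I_k -> Ebar).
Hypothesis xy : forall e, e = \sum_(i < k) lact E (p e (y i)) (x i).

(** The coaction of the canonical element sum_i y_i (x) x_i, paired with e. *)
Let K e : tensor A E := \sum_(i < k) \tsum_(y1, y0 <- dEbar (y i))
  \tsum_(x1, x0 <- dE (x i)) tens (y1 ⋅ x1) (lact E (p e y0) x0).

Lemma canonical_lin : lin K.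
Proof.
move=> c u v; rewrite /K scaler_sumr -big_split; apply: eq_bigr => i _.
have h : lin (fun e => \tsum_(y1, y0 <- dEbar (y i))
  \tsum_(x1, x0 <- dE (x i)) tens (y1 ⋅ x1) (lact E (p e y0) x0)) by mlin.
exact: h.
Qed.

Lemma coact_canonical e : dE e = \tsum_(e1, e0 <- dE e) \tsum_(k1, k0 <- K e0) tens (e1 ⋅ k1) k0.
Proof.
have dE_lin : lin dE := coact_linear dE_comod.
have hKt e1 : lin (fun t : tensor A E => \tsum_(k1, k0 <- t) tens (e1 ⋅ k1) k0) by mlin.
rewrite [in LHS](xy e) (lin_sum _ _ dE_lin).
under [RHS]eq_tsum do rewrite (lin_sum _ _ (hKt _)).
rewrite [RHS]exchange_big; apply: eq_bigr => i _ /=.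
have pc := p_colin.
rewrite (lact_colin (p e (y i)) (x i)) pc.
rewrite tsum_tsum; [|mlin|mlin].
rewrite -[RHS]/(\tsum_(e1, e0 <- dE e) \tsum_(k1, k0 <- \tsum_(y1, y0 <- dEbar (y i))
  \tsum_(x1, x0 <- dE (x i)) tens (y1 ⋅ x1) (lact E (p e0 y0) x0)) tens (e1 ⋅ k1) k0).
sweedler.
by rewrite (hmulA hA).
Qed.

(** The coaction of the expansion of e is e_(-1) K(e_(0)); compare with
    e_(-1) (x) e_(0) and multiply by S(e_(-2)). *)
Lemma canonical_coinvariant e : K e = tens one e.
Proof.
have hK := canonical_lin.
transitivity (\tsum_(a, m <- dE e) \tsum_(b, e0 <- dE m) \tsum_(k1, k0 <- K e0)
  tens (S a ⋅ (b ⋅ k1)) k0).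
  transitivity (\tsum_(z, e0 <- dE e) \tsum_(a, b <- D z) \tsum_(k1, k0 <- K e0)
    tens (S a ⋅ b ⋅ k1) k0); last by sweedler; rewrite (hmulA hA).
  under [RHS]eq_tsum => z e0.
    rewrite (antipodelE hA (f := fun v => \tsum_(k1, k0 <- K e0) tens (v ⋅ k1) k0)).
      under eq_tsum do rewrite (hmul1 hA).
      rewrite tsum_tens_id.
    over.
    by mlin.
  by rewrite (coact_counitE (f := K)).
transitivity (\tsum_(a, m <- dE e) \tsum_(b, e0 <- dE m) tens (S a ⋅ b) e0).
  apply: eq_tsum => a m; rewrite [in RHS]coact_canonical.
  rewrite [RHS]tsum_tsum; [|mlin|mlin]; apply: eq_tsum => b e0.
  rewrite [RHS]tsum_tsum; [|mlin|mlin]; apply: eq_tsum => k1 k0.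
  by rewrite tsum_tensE//; mlin.
transitivity (\tsum_(z, e0 <- dE e) \tsum_(a, b <- D z) tens (S a ⋅ b) e0).
  by sweedler.
under eq_tsum => z e0.
  rewrite (antipodelE hA (f := fun v => tens v e0)); last by mlin.
over.
by rewrite (coact_counitE (f := tens one))//; mlin.
Qed.

Let t i : tensor Ebar E := \tsum_(y1, y0 <- dEbar (y i)) \tsum_(x1, x0 <- dE (x i))
  gbar (tens y1 x1) *: tens y0 x0.

(** By the cocycle identity the deformed product p_g(e, n) z carries the functional
    g(n_(1), z_(1)) g(e_(1), n_(2) z_(2)), whose first factor is cancelled by the gbar
    in [t]; coinvariance then reduces the second to g(e_(1), 1). *)
Lemma twisted_expansion e :
  e = \sum_(i < k) \tsum_(n, z <- t i) tw dB dE (lact E) (pg e n) z.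
Proof.
have pb := twisted_pairing_bilin.
have lb : bilin (tw dB dE (lact E)) by apply: twist_prod_bilin => //; mlin.
pose L e1 (u : tensor A E) := \tsum_(k1, k0 <- u) g (tens e1 k1) *: k0.
have L_lin e1 : lin (L e1) by rewrite /L; mlin.
transitivity (\tsum_(e1, e0 <- dE e) L e1 (K e0)).
  under eq_tsum => e1 e0.
    rewrite canonical_coinvariant /L tsum_tensE; [|mlin|mlin].
    rewrite (cocycle1r hg).
  over.
  by rewrite (coact_counit dE_comod).
under eq_tsum do rewrite (lin_sum _ _ (L_lin _)).
rewrite [LHS]exchange_big; apply: eq_bigr => i _ /=.
rewrite -[LHS]/(\tsum_(e1, e0 <- dE e) L e1 (\tsum_(y1, y0 <- dEbar (y i))
  \tsum_(x1, x0 <- dE (x i)) tens (y1 ⋅ x1) (lact E (p e0 y0) x0))).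
transitivity (\tsum_(e1, e0 <- dE e) \tsum_(y1, y0 <- dEbar (y i))
  \tsum_(x1, x0 <- dE (x i)) g (tens e1 (y1 ⋅ x1)) *: lact E (p e0 y0) x0).
  by rewrite /L; sweedler.
symmetry.
transitivity (\tsum_(e1, e0 <- dE e) \tsum_(y1, n <- dEbar (y i))
   \tsum_(x1, z <- dE (x i)) gbar (tens y1 x1) *:
   (\tsum_(n1, n0 <- dEbar n) \tsum_(z1, z0 <- dE z)
    ((\tsum_(y, y' <- D n1) \tsum_(z, z' <- D z1)
       (g (tens y z) * g (tens e1 (y' ⋅ z')))) *: lact E (p e0 n0) z0))).
  rewrite /t tsum_tsum; [|mlin|mlin].
  under eq_tsum => y1 n.
    rewrite tsum_tsum; [|mlin|mlin].
    under eq_tsum => x1 z.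
      rewrite tsumZ; [|mlin|mlin].
      rewrite tsum_tensE; [|mlin|mlin].
      rewrite (twist_prodl hA g dE_comod dEbar_comod dE_comod dB_comod p_bil le_bil p_colin).
      under eq_tsum do under eq_tsum do under eq_tsum do rewrite (cocycleP hg).
      rewrite scale_tsum.
    over.
    rewrite tsumC.
  over.
  by rewrite tsumC.
apply: eq_tsum => e1 e0.
transitivity (\tsum_(u, y0 <- dEbar (y i)) \tsum_(v, x0 <- dE (x i))
  \tsum_(a, b <- D u) \tsum_(c, d <- D v)
  ((\tsum_(y1, y2 <- D a) \tsum_(x1, x2 <- D c)
     (gbar (tens y1 x1) * g (tens y2 x2))) * g (tens e1 (b ⋅ d))) *: lact E (p e0 y0) x0).
  under eq_tsum do under eq_tsum do rewrite scale_tsum.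
  under eq_tsum do under eq_tsum do under eq_tsum do rewrite scale_tsum.
  under eq_tsum do under eq_tsum do under eq_tsum do under eq_tsum do
    rewrite tsum_scale scale_tsum.
  under eq_tsum do under eq_tsum do under eq_tsum do under eq_tsum do under eq_tsum do
    rewrite tsum_scale scale_tsum.
  under [RHS]eq_tsum do under eq_tsum do under eq_tsum do under eq_tsum do
    rewrite tsum_mul tsum_scale.
  under [RHS]eq_tsum do under eq_tsum do under eq_tsum do under eq_tsum do under eq_tsum do
    rewrite tsum_mul tsum_scale.
  by cbv beta; sweedler; rewrite scalerA mulrA.
apply: eq_tsum => u y0; apply: eq_tsum => v x0.
transitivity (\tsum_(a, b <- D u) (eps a *: (g (tens e1 (b ⋅ v)) *: lact E (p e0 y0) x0))).
  apply: eq_tsum => a b; under eq_tsum do rewrite (cocycle_invl hg) -mulrA -!scalerA.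
  rewrite -scale_tsum; congr (_ *: _).
  by rewrite (coact_counitE (f := fun d => g (tens e1 (b ⋅ d)) *: lact E (p e0 y0) x0))//;
     [comod|mlin].
by rewrite (coact_counitE (f := fun b => g (tens e1 (b ⋅ v)) *: lact E (p e0 y0) x0))//;
   [comod|mlin].
Qed.
End Coinvariance.

Lemma twist_metric_dual_basis : exists (k : nat) (u : 'I_k -> E) (z : 'I_k -> Egbar),
  forall e : Eg, e = \sum_(j < k) lact Eg ((Hg (z j) : homB Eg) e) (u j).
Proof.
have [k [x [y xy]]] := pairing_dual_basis hB hE hH.
pose t i : tensor Ebar E := \tsum_(y1, y0 <- dEbar (y i)) \tsum_(x1, x0 <- dE (x i))
  gbar (tens y1 x1) *: tens y0 x0.
pose s := flatten [seq trepr (t i) | i <- enum 'I_k].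
exists (size s), (fun j => (tnth (in_tuple s) j).2),
  (fun j => bar (N' (tnth (in_tuple s) j).1) : Egbar) => e.
rewrite [LHS](twisted_expansion xy) -/t.
transitivity (\sum_(q <- s) tw dB dE (lact E) (pg e q.1) q.2).
  by rewrite big_flatten /= big_map big_enum.
rewrite big_tnth; apply: eq_bigr => j _.
by rewrite twist_metricE N'_K.
Qed.

Lemma twist_lact_bilin : bilin (tw dB dE (lact E)).
Proof. by apply: twist_prod_bilin => //; mlin. Qed.

Lemma twist_finitely_generated : finitely_generated (lact Eg).
Proof.
have [k [u [z uz]]] := twist_metric_dual_basis.
by exists k, u => e; exists (fun j => (Hg (z j) : homB Eg) e); exact: uz.
Qed.

Lemma twist_projective : projective (lact Eg).
Proof.
have [k [u [z uz]]] := twist_metric_dual_basis.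
move=> P Q actP actQ hP hQ pi f [pi_lin pi_act] pi_surj [f_lin f_act].
have [q hq] := choice (fun j => pi_surj (f (u j))).
have [al ar] := lact_bilinear hP.
exists (fun e => \sum_(j < k) actP ((Hg (z j) : homB Eg) e) (q j)); last first.
  move=> e; rewrite (lin_sum _ _ pi_lin) [in RHS](uz e) (lin_sum _ _ f_lin).
  by apply: eq_bigr => j _; rewrite pi_act f_act hq.
split=> [c v w|b e].
  rewrite scaler_sumr -big_split; apply: eq_bigr => j _ /=.
  by rewrite (homB_lin (Hg (z j))) al.
rewrite (lin_sum _ _ (ar b)); apply: eq_bigr => j _.
by rewrite homB_lact (lactA hP).
Qed.

(** By Hermitian symmetry H_g(m) determines the coefficients of m in the dual basis. *)
Lemma twist_metric_inj : injective Hg.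
Proof.
have [k [u [z uz]]] := twist_metric_dual_basis.
move=> m n mn; rewrite -[m]/(bar (unbar m)) -[n]/(bar (unbar n)); congr bar.
rewrite (uz (unbar m)) (uz (unbar n)); apply: eq_bigr => j _.
congr (lact Eg _ (u j)).
have e1 := twist_metric_herm (unbar m) (unbar (z j)).
have e2 := twist_metric_herm (unbar n) (unbar (z j)).
by apply: etrans (esym e1) _; apply: etrans _ e2; rewrite [Hg _]mn.
Qed.

Lemma twist_metric_expand : exists (k : nat) (u : 'I_k -> E) (z : 'I_k -> Egbar),
  forall h : homB Eg, h = \sum_(j < k) Hg (ract Egbar (z j) (h (u j))).
Proof.
have [k [u [z uz]]] := twist_metric_dual_basis.
exists k, u, z => h; apply: homB_eq => e.
rewrite (lin_sum _ _ (homB_eval_lin e)) [in LHS](uz e) (lin_sum _ _ (homB_lin h)).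
by apply: eq_bigr => j _; rewrite homB_lact twist_metric_ractE.
Qed.

(** The dual basis recovers h from the finitely many values h(u_j). *)
Lemma twist_hom_coact_uniq (t t' : tensor A (homB Eg)) :
  (forall e : E, \tsum_(a, h <- t) tens a ((h : homB Eg) e : B) =
     \tsum_(a, h <- t') tens a ((h : homB Eg) e : B)) -> t = t'.
Proof.
have [k [u [z hz]]] := twist_metric_expand.
have rb : bilin (tw dB dE (lact E)) := twist_lact_bilin.
have hr j : lin (fun b : B => Hg (ract Egbar (z j) b) : homB Eg).
  move=> c b b'; apply: homB_eq => e;
  have r x := twist_metric_ractE (z j) x e.
  apply: etrans (r (c *: b + b')) _.
  rewrite [RHS](homB_eval_lin e c).
  rewrite (r b).
  rewrite (r b').
  exact: ((bilin_bundled (bmul Bg)).2 ((Hg (z j) : homB Eg) e) c b b').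
have expand (s : tensor A (homB Eg)) : s = \sum_(j < k)
    \tsum_(a, b <- \tsum_(a, h <- s) tens a ((h : homB Eg) (u j) : B))
      tens a (Hg (ract Egbar (z j) b) : homB Eg).
  rewrite -[LHS]tsum_tens_id.
  transitivity (\tsum_(a, h <- s) \sum_(j < k)
      tens a (Hg (ract Egbar (z j) ((h : homB Eg) (u j))) : homB Eg)).
    apply: eq_tsum => a h; rewrite {1}(hz h).
    exact: (lin_sum _ _ ((tens_bilin _ _).2 a)).
  rewrite [LHS]exchange_big; apply: eq_bigr => j _ /=.
  have hrj := hr j.
  rewrite [RHS]tsum_tsum; [|mlin|mlin].
  apply: eq_bigr => -[a h] _ /=; rewrite tsum_tensE; [by []|mlin|mlin].
move=> e; rewrite (expand t); under eq_bigr do rewrite e.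
by rewrite -expand.
Qed.

Notation V := (cocV g).
Notation Vbar := (cocVbar gbar).
Let V_slin : slin V := cocV_slin hA g.
Let Vbar_slin : slin Vbar := cocVbar_slin hA gbar.

(** In the deformed involution Vbar(a_(1)^* ) a_(2)^* V(a_(3)^* ), the last factor is
    cancelled by the Vbar of the map N. *)
Lemma frakN_colinear e :
  \tsum_(e1, e0 <- dE e) tens (hstar Ag e1 : A) (N e0) = dEbar (N e).
Proof.
have NE f : N f = \tsum_(n1, n0 <- dEbar (bar f)) Vbar n1 *: n0.
  exact: conj_twistE.
pose hs (k : A) : A := \tsum_(k1, k23 <- D k) \tsum_(k2, k3 <- D k23)
  (Vbar k1 * V k3) *: k2.
have hs_lin : lin hs by rewrite /hs; mlin.
have hsE a : hstar Ag a = hs (hstar A a).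
  rewrite /hs (tsum_comul_star hA); [|mlin|mlin].
  by under [RHS]eq_tsum do (rewrite (tsum_comul_star hA); [|mlin|mlin]).
under eq_tsum do rewrite hsE NE.
pose L (n : Ebar) : Ebar := \tsum_(n1, n0 <- dEbar n) Vbar n1 *: n0.
have L_lin : lin L by rewrite /L; mlin.
transitivity (\tsum_(n1, n0 <- dEbar (bar e)) tens (hs n1) (L n0)).
  by rewrite tsum_conj_coact//; mlin.
rewrite NE; set n := bar e.
transitivity (\tsum_(n1, m <- dEbar n) \tsum_(n2, m' <- dEbar m) \tsum_(x, n0 <- dEbar m')
  ((\tsum_(a, b <- D x) (V a * Vbar b)) *: (Vbar n1 *: tens n2 n0))).
  under [RHS]eq_tsum do under eq_tsum do under eq_tsum do rewrite tsum_scale.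
  under eq_tsum => n1 n0.
    rewrite /hs (lin_tsum _ _ ((tens_bilin _ _).1 _)).
    under eq_tsum => a b.
      rewrite (lin_tsum _ _ ((tens_bilin _ _).1 _)).
      under eq_tsum => c d.
        rewrite (linZ _ _ ((tens_bilin _ _).1 _)) /L.
        rewrite (lin_tsum _ _ ((tens_bilin _ _).2 _)) scale_tsum.
        under eq_tsum do rewrite (linZ _ _ ((tens_bilin _ _).2 _)).
      over.
    over.
  over.
  cbv beta; sweedler.
  by rewrite !scalerA; congr (_ *: _); ring.
rewrite (lin_tsum _ _ (coact_linear dEbar_comod)).
apply: eq_tsum => n1 m; rewrite (linZ _ _ (coact_linear dEbar_comod)).
rewrite -[dEbar m in RHS]tsum_tens_id scale_tsum; apply: eq_tsum => n2 m'.
under eq_tsum do rewrite (cocV_Vbar hA hg).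
by rewrite (coact_counitE (f := fun n0 => Vbar n1 *: tens n2 n0))//; mlin.
Qed.

Let antipode_mul (x y : A) : A := hmul Ag (antipode Ag x) y.

Lemma antipode_mul_bilin : bilin antipode_mul.
Proof.
have hm := hmul_twist_bilin hA g gbar.
split=> [y|x]; last exact: (hm.2 (antipode Ag x)).
have hS : lin (antipode Ag : A -> A).
  have hU := cocU_slin hA g; have hUb := cocUbar_slin hA gbar.
  by rewrite /=; mlin.
exact: (lin_comp (hm.1 y) hS).
Qed.

Lemma twisted_pairing_coact (v : E) (n : Ebar) :
  \tsum_(v1, v0 <- dE v) \tsum_(w1, w0 <- dB (pg v0 n)) tens (antipode_mul v1 w1) w0 =
  \tsum_(n1, n0 <- dEbar n) tens n1 (pg v n0).
Proof.
have hS := antipode_mul_bilin; have pc := p_colin.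
have dBl : lin dB := coact_linear dB_comod.
transitivity (\tsum_(a, v0 <- dE v) \tsum_(b, n0 <- dEbar n)
  tens (\tsum_(x, t <- D a) \tsum_(y, z <- D t) \tsum_(c, d <- D b)
    (g (tens y c) *: antipode_mul x (z ⋅ d))) (p v0 n0)).
  under eq_tsum => v1 v0.
    rewrite {1}/twist_prod (lin_tsum _ _ dBl).
    rewrite tsum_tsum; [|mlin|mlin].
    under eq_tsum => x1 x0.
      rewrite (lin_tsum _ _ dBl).
      rewrite tsum_tsum; [|mlin|mlin].
      under eq_tsum => n1 n0.
        rewrite (linZ _ _ dBl) pc tsumZ; [|mlin|mlin].
        rewrite tsum_tsum; [|mlin|mlin].
        rewrite scale_tsum.
        under eq_tsum => y1 y0.
          rewrite tsum_tsum; [|mlin|mlin].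
          rewrite scale_tsum.
          under eq_tsum do (rewrite tsum_tensE; [|mlin|mlin]).
        over.
      over.
    over.
  over.
  under [RHS]eq_tsum => a v0.
    under eq_tsum => b n0.
      rewrite (lin_tsum _ _ ((tens_bilin _ _).1 _)).
      under eq_tsum => x t.
        rewrite (lin_tsum _ _ ((tens_bilin _ _).1 _)).
        under eq_tsum => y z.
          rewrite (lin_tsum _ _ ((tens_bilin _ _).1 _)).
          under eq_tsum do rewrite (linZ _ _ ((tens_bilin _ _).1 _)).
        over.
      over.
    over.
  over.
  cbv beta; sweedler.
under eq_tsum do under eq_tsum do rewrite [X in tens X _](twisted_antipode_cancel hA hg).
under eq_tsum => a v0.
  under eq_tsum => b n0.
    rewrite (lin_tsum _ _ ((tens_bilin _ _).1 _)).
    under eq_tsum do rewrite (linZ _ _ ((tens_bilin _ _).1 _)).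
  over.
over.
under [RHS]eq_tsum => n1 n0.
  rewrite /twist_prod (lin_tsum _ _ ((tens_bilin _ _).2 _)).
  under eq_tsum => x1 x0.
    rewrite (lin_tsum _ _ ((tens_bilin _ _).2 _)).
    under eq_tsum do rewrite (linZ _ _ ((tens_bilin _ _).2 _)).
  over.
over.
rewrite [RHS]tsumC.
cbv beta; sweedler.
Qed.

Lemma twist_metric_coact (m : Egbar) : coact (hom_bimod Eg) (Hg m) =
  \tsum_(m1, m0 <- coact Egbar m) tens m1 (Hg m0).
Proof.
have Hl := twist_metric_lin; have hev := @homB_eval_lin _ _ _ Eg.
have pb := twisted_pairing_bilin.
pose t0 : tensor A (homB Eg) := \tsum_(e1, e0 <- dE (unbar m))
  tens (hstar Ag e1 : A) (Hg (bar e0) : homB Eg).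
have -> : \tsum_(m1, m0 <- coact Egbar m) tens m1 (Hg m0) = t0.
  pose G (a : A) (n : Egbar) : tensor A (homB Eg) := tens a (Hg n : homB Eg).
  rewrite -[LHS]/(tsum G (\tsum_(e1, e0 <- dE (unbar m)) tens (hstar Ag e1 : A) (bar e0 : Egbar))).
  rewrite tsum_tsum; [|rewrite /G; mlin|rewrite /G; mlin].
  by apply: eq_tsum => e1 e0; rewrite tsum_tensE// /G; mlin.
have t0E (v : E) : \tsum_(a, h <- t0) tens a ((h : homB Eg) v : B) =
    \tsum_(v1, v0 <- dE v) \tsum_(w1, w0 <- dB ((Hg m : homB Eg) v0)) tens (antipode_mul v1 w1) w0.
  under [RHS]eq_tsum do rewrite twist_metricE.
  have hv := hev v.
  rewrite twisted_pairing_coact -frakN_colinear /t0.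
  rewrite [RHS]tsum_tsum; [|mlin|mlin].
  rewrite [LHS]tsum_tsum; [|mlin|mlin].
  apply: eq_tsum => e1 e0; rewrite !tsum_tensE; try mlin.
  by rewrite twist_metricE.
apply: (@xget_unique _ 0 [set t : tensor A (homB Eg) | forall v : E,
  \tsum_(a, h <- t) tens a ((h : homB Eg) v : B) =
    \tsum_(v1, v0 <- dE v) \tsum_(w1, w0 <- dB ((Hg m : homB Eg) v0)) tens (antipode_mul v1 w1) w0]%classic).
  exact: t0E.
by move=> t ht; apply: twist_hom_coact_uniq => v; rewrite ht t0E.
Qed.

Lemma twist_metric_morphism : is_morphism Hg.
Proof.
split; [exact: twist_metric_lin | exact: twist_metric_lact
  | exact: twist_metric_ract | exact: twist_metric_coact].
Qed.

Lemma twist_metric_isomorphism : is_isomorphism Hg.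
Proof.
split; first exact: twist_metric_morphism.
have [k [u [z hz]]] := twist_metric_expand.
pose G (h : hom_bimod Eg) : Egbar := \sum_(j < k) ract Egbar (z j) ((h : homB Eg) (u j)).
have HG : cancel G Hg.
  by move=> h; rewrite [RHS]hz /G; apply: (lin_sum _ _ twist_metric_lin).
have GH : cancel Hg G by move=> n; apply: twist_metric_inj; rewrite HG.
exists G; split=> //.
exact: morphism_inv twist_metric_morphism GH HG.
Qed.

Theorem twist_metric_hermitian : is_hermitian_metric Hg.
Proof.
split; [exact: twist_finitely_generated | exact: twist_projective
  | exact: twist_metric_isomorphism | exact: twist_metric_herm].
Qed.

End TwistedMetric.

Theorem theorem4p4 (R : realType) (A : hopfStarData R[i]) (B : comodStarData A)
    (E : bimodData B)
    (hA : is_hopf_star_algebra A) (hB : is_comodule_star_algebra B)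
    (hE : is_covariant_bimodule E)
    (hfg : finitely_generated (lact E)) (hproj : projective (lact E))
    (H : conj_bimod E -> hom_bimod E) (hH : is_hermitian_metric H)
    (g gbar : {scalar tensor A A}) (hg : is_unitary_2cocycle g gbar) :
  is_hermitian_metric (twist_metric g gbar H).
Proof. exact: twist_metric_hermitian. Qed.
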